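(* Let $\mu$ be a probability measure on $\Omega$ which is stationary ergodic with respect to the $\mathbb Z$-shift $\theta$ and elliptic. Then there is a deterministic $v\in[-1,1]$ such that $\mathbb P_0\big(\lim_{n\to\infty}X_n/n=v\big)=1$.
   Context: Notation: $\mathbb N=\{1,2,\dots\}$. A cookie environment is $\omega\in\Omega=[0,1]^{\mathbb Z\times\mathbb N}$ (with the product Borel $\sigma$-algebra); $\omega(x,n)$ is the $n$-th cookie at site $x$. The shift $\theta$ acts by $(\theta\omega)(x,n)=\omega(x+1,n)$. A probability measure $\mu$ on $\Omega$ is stationary ergodic if it is $\theta$-invariant and ergodic for $\theta$, and elliptic if $\mu((0,1)^{\mathbb Z\times\mathbb N})=1$. For $\omega\in\Omega$ and $x\in\mathbb Z$, the excited random walk under $P_{\omega,x}$ is the process $(X_n)_{n\ge0}$ with $X_0=x$ and, conditionally on $X_0,\dots,X_{n-1}$, $X_n=X_{n-1}+1$ with probability $\omega(X_{n-1},\#\{k\le n-1:X_k=X_{n-1}\})$ and $X_n=X_{n-1}-1$ otherwise. The annealed law is $\mathbb P_x(\cdot)=\int_\Omega P_{\omega,x}(\cdot)\,d\mu(\omega)$. *)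

(* Defs.v *)
From HB Require Import structures.
From mathcomp Require Import all_boot all_order all_algebra.
From mathcomp Require Import all_classical all_reals all_analysis.
Set Implicit Arguments. Unset Strict Implicit. Unset Printing Implicit Defensive.
Import Order.TTheory GRing.Theory Num.Theory.
Local Open Scope classical_set_scope.
Local Open Scope ring_scope.

(** Cookie environments.  [env R] is the type of maps [int -> nat -> R];
    [w x c] stands for the cookie ω(x, c+1) (the (c+1)-th cookie at site x),
    i.e. the index set ℤ × ℕ (ℕ = {1,2,...}) is encoded as [int * nat] with
    a shift by one in the second coordinate.  Cookie values lie in [0,1]
    μ-almost surely (ellipticity gives (0,1) a.s.). *)
Definition env (R : realType) := int -> nat -> R.
HB.instance Definition _ (R : realType) := gen_eqMixin (env R).
HB.instance Definition _ (R : realType) := gen_choiceMixin (env R).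
HB.instance Definition _ (R : realType) :=
  isPointed.Build (env R) (fun _ _ => 0%R).

Definition cyl_sets (R : realType) : set (set (env R)) :=
  [set A | exists (x : int) (c : nat) (B : set R),
      measurable B /\ A = [set w | B (w x c)]].

Definition Env (R : realType) := g_sigma_algebraType (@cyl_sets R).

Definition shift (R : realType) (w : Env R) : Env R := fun x c => w (x + 1) c.

Definition stationary (R : realType) (mu : probability (Env R) R) : Prop :=
  forall A : set (Env R), measurable A -> mu (@shift R @^-1` A) = mu A.

Definition ergodic (R : realType) (mu : probability (Env R) R) : Prop :=
  forall A : set (Env R), measurable A -> @shift R @^-1` A = A ->
    mu A = 0%E \/ mu A = 1%E.

Definition elliptic (R : realType) (mu : probability (Env R) R) : Prop :=
  mu [set w : Env R | forall (x : int) (c : nat), 0 < w x c < 1] = 1%E.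

(** Quenched transition probability of the k-th step of the path [xs]
    (from xs_k to xs_{k+1}): the walker at y = xs_k uses the cookie
    number #{j <= k : xs_j = y} at site y. *)
Definition qstep (R : realType) (w : env R) (xs : seq int) (k : nat) : R :=
  let y := nth 0 xs k in
  let p := w y (count (pred1 y) (take k.+1 xs)).-1 in
  if nth 0 xs k.+1 == y + 1 then p
  else if nth 0 xs k.+1 == y - 1 then 1 - p else 0.

Definition qprob (R : realType) (w : env R) (xs : seq int) : R :=
  match xs with
  | [::] => 1
  | x0 :: _ => (x0 == 0)%:R * \prod_(k < (size xs).-1) qstep w xs k
  end.

(** [X] (defined on the probability space (T, P)) has the annealed law
    P_0 = ∫ P_{ω,0} dμ(ω) of the excited random walk started at 0:
    all its finite-dimensional distributions are the annealed ones. *)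
Definition annealed_walk (R : realType) (mu : probability (Env R) R)
    (d : measure_display) (T : measurableType d) (P : probability T R)
    (X : nat -> T -> int) : Prop :=
  forall xs : seq int,
    measurable [set t | forall k, (k < size xs)%N -> X k t = nth 0 xs k] /\
    P [set t | forall k, (k < size xs)%N -> X k t = nth 0 xs k] =
      (\int[mu]_w (qprob w xs)%:E)%E.

(* Main.v *)
Require Import Defs.
From HB Require Import structures.
From mathcomp Require Import all_boot all_order all_algebra.
From mathcomp Require Import all_classical all_reals all_analysis.
From mathcomp Require Import measurable_realfun.
From mathcomp Require Import zify ring lra.
Import Order.TTheory GRing.Theory Num.Theory numFieldNormedType.Exports.
Local Open Scope classical_set_scope.
Local Open Scope ring_scope.
Set Implicit Arguments. Unset Strict Implicit. Unset Printing Implicit Defensive.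

(** A quenched law is realised by a stack of independent arrows at each site,
    the [n]-th visit to [x] following the [n]-th arrow at [x]; the walk is then a
    deterministic function of the arrows, and the annealed law of the arrows is
    again stationary and ergodic.

    Let [V] be the number of visits to 0 of the walk kept in [[0, +oo)] by
    ignoring the left arrows at 0.  For [x >= 0] the number of visits to [x] of
    the walk from 0 is at most [V] of the arrows shifted by [x], and at least the
    number of such visits in the first [k] steps as soon as [x + k] has been
    reached.  By Birkhoff's theorem the time to reach [N] grows at least like
    [N E(V)]: if [E(V)] is infinite, limsup X_n / n <= 0.  If [E(V)] is finite,
    the walk visits each site finitely often, so it is bounded above or tends to
    [+oo]; in the latter case each backtrack is charged to the o(N) visits still
    to be made below the current maximum [N], and X_n / n tends to 1 / E(V).

    Tending to [+oo] has probability 0 or 1: comparing odometers (the least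
    action principle of abelian networks), if the walk from 0 tends to [+oo],
    then so does the walk from 1 in the same arrows, so this event is included in
    its shift.  Hence either X_n / n converges to a positive constant, or
    limsup X_n / n <= 0; reflecting the arrows gives the same dichotomy on the
    left, and the theorem follows. *)

(** * Walks driven by arrows *)

(** The trajectory is stored with the latest position first. The count in the tail is the number of
    earlier visits to the current site, that is, the index from 0 of the arrow used there. A
    displacement of 0 is allowed: it consumes an arrow without moving. *)
Fixpoint hist (D : int -> nat -> int) (x : int) (n : nat) : seq int :=
  if n is m.+1 then
    let h := hist D x m in
    (head 0 h + D (head 0 h) (count_mem (head 0 h) (behead h))) :: h
  else [:: x].

Definition pos (D : int -> nat -> int) (x : int) (n : nat) : int :=
  head 0 (hist D x n).

(** Only the times before [n] are counted, so this is the number of arrows consumed at [z] by time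
    [n]. *)
Definition visits (D : int -> nat -> int) (x : int) (n : nat) (z : int) : nat :=
  count_mem z (behead (hist D x n)).

Definition free (a : int -> nat -> bool) (y : int) (c : nat) : int :=
  if a y c then 1 else -1.

(** A left arrow at 0 makes the walk wait one step: each visit still consumes one arrow, and the
    indices stay aligned with those of the free walk. *)
Definition reflected (a : int -> nat -> bool) (y : int) (c : nat) : int :=
  if a y c then 1 else if y == 0 then 0 else -1.

Definition shiftn (i : nat) (a : int -> nat -> bool) : int -> nat -> bool :=
  fun x c => a (x + i%:Z) c.

Definition transient (a : int -> nat -> bool) (x : int) : Prop :=
  forall L : int, exists n0, forall n, (n0 <= n)%N -> L < pos (free a) x n.

Section Walk.
Variables (D : int -> nat -> int) (x : int).

Lemma hist_cons n : hist D x n = pos D x n :: behead (hist D x n).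
Proof. by case: n. Qed.

Lemma posS n :
  pos D x n.+1 = pos D x n + D (pos D x n) (visits D x n (pos D x n)).
Proof. by []. Qed.

Lemma visitsS n z :
  visits D x n.+1 z = (visits D x n z + (pos D x n == z))%N.
Proof. by rewrite /visits /= {1}hist_cons /= addnC. Qed.

Lemma visits_le n m z : (n <= m)%N -> (visits D x n z <= visits D x m z)%N.
Proof.
move=> /subnKC <-; elim: (m - n)%N => [|k IH]; first by rewrite addn0.
by rewrite addnS visitsS (leq_trans IH)// leq_addr.
Qed.

Lemma sum_visits_le n N : (\sum_(i < N) visits D x n i%:Z <= n)%N.
Proof.
elim: n => [|n IH]; first by rewrite big1.
under eq_bigr do rewrite visitsS.
rewrite big_split /= -addn1 leq_add//.
case: (boolP [exists i : 'I_N, pos D x n == i%:Z]).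
  case/existsP => i /eqP ->.
  rewrite (bigD1 i)//= big1 ?addn0; first by case: eqP.
  by move=> j ji; case: eqP => // -[] /val_inj ij; rewrite ij eqxx in ji.
rewrite negb_exists => /forallP h.
by rewrite big1// => i _; rewrite (negbTE (h i)).
Qed.

(** Induction on the bound: if [z] is visited after every time, each count is followed by a strictly
    larger one, so the bound can be lowered by one. *)
Lemma eventually_neq z B : (forall n, visits D x n z <= B)%N ->
  exists n0, forall n, (n0 <= n)%N -> pos D x n != z.
Proof.
elim: B => [|B IH] h.
  exists 0%N => n _; apply/negP => e; have := h n.+1.
  by rewrite visitsS e addn1.
have [//|hn] := EM (exists n0, forall n, (n0 <= n)%N -> pos D x n != z).
apply: IH => n.
have [m nm /eqP pm] : exists2 m, (n <= m)%N & pos D x m == z.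
  apply: contrapT => h'; apply: hn; exists n => m nm.
  by apply/negP => e; apply: h'; exists m.
have := h m.+1; rewrite visitsS pm eqxx addn1 ltnS; apply: leq_trans.
exact: visits_le.
Qed.

Lemma running_max n : exists M : int, x <= M /\
  (exists2 k, (k <= n)%N & pos D x k = M) /\
  (forall k, (k <= n)%N -> pos D x k <= M).
Proof.
elim: n => [|n [M [xM [[k kn kM] hM]]]].
  by exists x; split => //; split => [|k]; [exists 0%N|rewrite leqn0 => /eqP ->].
have [h|h] := leP (pos D x n.+1) M.
  exists M; split => //; split; first by exists k => //; exact: leqW.
  by move=> j; rewrite leq_eqVlt => /predU1P[->//|]; rewrite ltnS; apply: hM.
exists (pos D x n.+1); split; first by apply: le_trans (ltW h).
split; first by exists n.+1.
move=> j; rewrite leq_eqVlt => /predU1P[->//|]; rewrite ltnS => jn.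
by apply: le_trans (ltW h); apply: hM.
Qed.

End Walk.

Lemma pos_shift D x y n :
  pos D (y + x) n = pos (fun z c => D (z + x) c) y n + x /\
  (forall z, visits D (y + x) n (z + x) = visits (fun z c => D (z + x) c) y n z).
Proof.
elim: n => [|n [IH1 IH2]]; first by [].
split; first by rewrite !posS IH1 IH2; ring.
by move=> z; rewrite !visitsS IH1 IH2 (inj_eq (addIr x)).
Qed.

Lemma pos_opp D x n :
  pos (fun z c => - D (- z) c) (- x) n = - pos D x n /\
  (forall z, visits (fun z c => - D (- z) c) (- x) n (- z) = visits D x n z).
Proof.
elim: n => [|n [IH1 IH2]]; first by [].
split; first by rewrite !posS IH1 IH2 opprK; ring.
by move=> z; rewrite !visitsS IH1 IH2 eqr_opp.
Qed.

(** * The free walk compared with reflected walks in shifted arrows *)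

Section Free.
Variable a : int -> nat -> bool.
Let X := pos (free a) 0.
Let u := visits (free a) 0.

Lemma free_step x n : pos (free a) x n.+1 = pos (free a) x n + 1 \/
  pos (free a) x n.+1 = pos (free a) x n - 1.
Proof. by rewrite posS /free; case: (a _ _); [left|right]. Qed.

Let uS n z : u n.+1 z = (u n z + (X n == z))%N.
Proof. exact: visitsS. Qed.

Lemma pos_reflected_le b n : pos (reflected b) 0 n <= n%:Z.
Proof.
elim: n => [//|n]; rewrite posS; move: (pos _ _ n) => p IH.
by rewrite /reflected; case: (b _ _) => /=; [lia|case: eqP; lia].
Qed.

(* After its first visit to [i], the walk seen on [[i, +oo)] is the walk in the
   shifted arrows reflected at the origin, run at its own speed. *)
Lemma simulation (i n : nat) :
  (X n < i%:Z /\ forall z, 0 <= z -> u n (z + i%:Z) = 0%N) \/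
  exists j, pos (reflected (shiftn i a)) 0 j = Num.max (X n - i%:Z) 0 /\
    forall z, 0 <= z ->
      visits (reflected (shiftn i a)) 0 j z = u n (z + i%:Z).
Proof.
elim: n => [|n [[Xi h]|[j [pj h]]]].
- case: i => [|i]; last by left.
  by right; exists 0%N.
- have [Xi'|Xi'] := ltP (X n.+1) i%:Z.
    left; split => // z z0; rewrite uS h//.
    by case: eqP => //; lia.
  right; exists 0%N; split.
    have : X n.+1 <= X n + 1 by rewrite /X; have := free_step 0 n; lia.
    by rewrite /pos/=; lia.
  by move=> z z0; rewrite uS h//; case: eqP => //; lia.
- right.
  have [Xi|Xi] := ltP (X n) i%:Z.
    exists j; rewrite pj; split.
      by have := free_step 0 n; rewrite -!/(X _); lia.
    by move=> z z0; rewrite uS h//; case: eqP; lia.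
  have XE : X n - i%:Z + i%:Z = X n by ring.
  have pj' : pos (reflected (shiftn i a)) 0 j = X n - i%:Z by rewrite pj; lia.
  exists j.+1; split.
    rewrite posS pj' h ?XE; last by lia.
    rewrite /X posS -/(X n) -/(u n); move: Xi XE {pj pj'}; move: (X n) => p Xi XE.
    rewrite /reflected /free /shiftn XE.
    by case: (a _ _) => /=; [lia|case: eqP; lia].
  move=> z z0; rewrite visitsS uS h// pj'.
  by congr (_ + nat_of_bool _)%N; lia.
Qed.

(** Truncation at time [k] of the number of visits to 0; it is nondecreasing in [k], and its limit
    is the possibly infinite variable [V]. *)
Definition returns (k : nat) (b : int -> nat -> bool) : nat :=
  visits (reflected b) 0 k 0.

(** In its own time [j] the reflected walk stands at distance at least [k] from its start, and it
    moves by at most 1 per step, so [k <= j]. *)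
Lemma returns_le_visits (i k n : nat) : i%:Z + k%:Z <= X n ->
  (returns k (shiftn i a) <= u n i%:Z)%N.
Proof.
move=> h; have [[]|[j [pj hj]]] := simulation i n; first by lia.
have := hj 0 (lexx _); rewrite add0r => <-; apply: visits_le.
by have := pos_reflected_le (shiftn i a) j; rewrite pj; lia.
Qed.

Lemma visits_le_returns (i n : nat) :
  exists k, (u n i%:Z <= returns k (shiftn i a))%N.
Proof.
have [[_ h]|[j [_ hj]]] := simulation i n.
  by exists 0%N; have := h 0 (lexx _); rewrite add0r => ->.
by exists j; have := hj 0 (lexx _); rewrite add0r => <-.
Qed.

(** The sites [i] of the sum are those with [i + k <= M], for which the truncated returns are
    genuine visits of the free walk before time [m]. The subtraction is truncated: the sum is empty
    when [k > M]. *)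
Lemma sum_returns_le (k n M m : nat) : (m <= n)%N -> X m = M%:Z ->
  (\sum_(i < M.+1 - k) returns k (shiftn i a) <= n)%N.
Proof.
move=> mn XM; apply: leq_trans (sum_visits_le (free a) 0 n (M.+1 - k)).
apply: leq_sum => i _; apply: leq_trans (visits_le _ _ _ mn).
by apply: returns_le_visits; rewrite -/(X m) XM; have := ltn_ord i; lia.
Qed.

(** After some time the walk avoids 0, ..., |L|. Once above |L| after that time, it cannot return by
    unit steps. *)
Lemma transientP : (forall i : nat, exists B, forall n, (u n i%:Z <= B)%N) ->
  (forall L : nat, exists n, L%:Z < X n) -> transient a 0.
Proof.
move=> hB hsup L.
have [n0 hn0] : exists n0, forall n, (n0 <= n)%N -> forall i : nat, (i <= `|L|)%N ->
    X n != i%:Z.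
  elim: `|L|%N => [|l [n0 h0]].
    have [B /eventually_neq [n0 h0]] := hB 0%N.
    by exists n0 => n nn0 i; rewrite leqn0 => /eqP ->; exact: h0.
  have [B /eventually_neq [n1 h1]] := hB l.+1.
  exists (maxn n0 n1) => n nn i.
  rewrite leq_eqVlt => /predU1P[->|il]; first by apply: h1; lia.
  by apply: h0; lia.
(* Since [X n <= n], a position beyond [|L| + n0] is reached only after time [n0]. *)
have [n1 [hn1 h1]] : exists n1, (n0 <= n1)%N /\ `|L|%:Z < X n1.
  have [n h] := hsup (`|L| + n0)%N.
  exists n; split; last by lia.
  suff : X n <= n%:Z by lia.
  elim: {h} n => [//|n IH]; have := free_step 0 n; rewrite -!/(X _); lia.
exists n1 => n /subnKC <-; apply: le_lt_trans (_ : `|L|%:Z < _); first by lia.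
elim: (n - n1)%N => [|k IH]; first by rewrite addn0.
have nk : (n0 <= (n1 + k).+1)%N by lia.
rewrite addnS; move: IH; rewrite -!/(X _) => IH.
have := hn0 _ nk `|L|%N (leqnn _).
by have := free_step 0 (n1 + k); rewrite -!/(X _); lia.
Qed.

Let below (n : nat) (M : int) : nat := (\sum_(k < n) (X k <= M)%R)%N.

Let belowS n M : below n.+1 M = (below n M + (X n <= M)%R)%N.
Proof. by rewrite /below big_ord_recr. Qed.

(* After time [n] the walk still visits every site of [(X n, M]]. *)
Lemma pos_ge (C n M : nat) (V : nat -> nat) :
  (forall L : nat, exists2 n', (n <= n')%N & L%:Z < X n') ->
  (forall k, (C <= k)%N -> 0 <= X k) ->
  (forall k, (k <= n)%N -> X k <= M%:Z) ->
  (forall n' (i : nat), (u n' i%:Z <= V i)%N) ->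
  n%:Z + M%:Z + 1 - C%:Z - (\sum_(i < M.+1) V i)%N%:Z <= X n.
Proof.
move=> hsup hC hM hV.
have [n' nn' hn'] := hsup M.
(* The walk capped at [M + 1] gains at most 1 in a step started at or below [M], and cannot gain in
   any other step. *)
have H1 : Num.min (X n') (M%:Z + 1) - Num.min (X n) (M%:Z + 1) <=
    (below n' M%:Z)%:Z - (below n M%:Z)%:Z.
  rewrite -(subnKC nn'); elim: (n' - n)%N => [|k IH]; first by rewrite addn0; lia.
  rewrite addnS belowS; have := free_step 0 (n + k); rewrite -!/(X _).
  by case: (leP (X (n + k)) M%:Z); lia.
have H2 : below n M%:Z = n.
  rewrite /below (eq_bigr (fun=> 1%N)) ?sum1_card ?card_ord// => k _.
  by rewrite hM// ltnW.
(* The times before [C] count for at most [C]; afterwards the walk is nonnegative, so the times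
   spent at or below [M] are visits to 0, ..., [M]. *)
have H3 : (below n' M%:Z <= C + \sum_(i < M.+1) V i)%N.
  suff : (below n' M%:Z <= minn n' C + \sum_(i < M.+1) u n' i%:Z)%N.
    have : (\sum_(i < M.+1) u n' i%:Z <= \sum_(i < M.+1) V i)%N.
      by apply: leq_sum => i _; exact: hV.
    by have := geq_minr n' C; lia.
  elim: (n') => [|m IH]; first by rewrite /below big_ord0.
  rewrite belowS; under eq_bigr do rewrite uS.
  rewrite big_split /=.
  have [mC|Cm] := ltnP m C.
    rewrite (minn_idPl mC); move: IH; rewrite (minn_idPl (ltnW mC)) => IH.
    apply: leq_trans (leq_add IH (leq_b1 _)) _.
    by rewrite addn1 addSn ltnS addnA leq_addr.
  move: IH; rewrite (minn_idPr Cm) (minn_idPr (leqW Cm)) => IH.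
  case: (boolP (X m <= M%:Z)) => [XM|_]; last first.
    by rewrite addn0 (leq_trans IH)// leq_add2l leq_addr.
  have XmM : (`|X m| < M.+1)%N by have := hC _ Cm; lia.
  rewrite [X in (_ <= _ + (_ + X))%N](bigD1 (Ordinal XmM))//=.
  have -> : X m == `|X m|%:Z by have := hC _ Cm; lia.
  by rewrite addnA leq_add// addnA leq_addr.
have : X n <= M%:Z by exact: hM.
by lia.
Qed.

End Free.

(** * Comparison of the odometers of the walks from 0 and from 1 *)

Section Abelian.
Variable a : int -> nat -> bool.

Let R z m : nat := (\sum_(j < m) a z j)%N.
Let L z m : nat := (\sum_(j < m) ~~ a z j)%N.

Let RS z m : R z m.+1 = (R z m + a z m)%N.
Proof. by rewrite /R big_ord_recr. Qed.

Let LS z m : L z m.+1 = (L z m + ~~ a z m)%N.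
Proof. by rewrite /L big_ord_recr. Qed.

Let R_le z m m' : (m <= m')%N -> (R z m <= R z m')%N.
Proof.
move=> /subnKC <-; elim: (_ - _)%N => [|k IH]; first by rewrite addn0.
by rewrite addnS RS (leq_trans IH)// leq_addr.
Qed.

Let L_le z m m' : (m <= m')%N -> (L z m <= L z m')%N.
Proof.
move=> /subnKC <-; elim: (_ - _)%N => [|k IH]; first by rewrite addn0.
by rewrite addnS LS (leq_trans IH)// leq_addr.
Qed.

Let RLE z m : (R z m + L z m)%N = m.
Proof.
elim: m => [|m IH]; first by rewrite /R /L !big_ord0.
by rewrite RS LS; case: (a z m) => /=; lia.
Qed.

Let stepE x n (X := pos (free a) x) (u := visits (free a) x) z :
  R z (u n.+1 z) = (R z (u n z) + ((X n == z) && a z (u n z)))%N /\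
  L z (u n.+1 z) = (L z (u n z) + ((X n == z) && ~~ a z (u n z)))%N.
Proof.
rewrite /u visitsS; case: eqP => _ /=; last by rewrite !addn0.
by rewrite addn1 RS LS.
Qed.

(** Conservation across the edge from [z - 1] to [z]: right crossings minus left crossings equal the
    change of the indicator of being at or beyond [z]. *)
Let flow x n (z : int) : (R (z - 1) (visits (free a) x n (z - 1)) + (z <= x)%R =
  L z (visits (free a) x n z) + (z <= pos (free a) x n)%R)%N.
Proof.
elim: n => [|n IH]; first by rewrite /R /L /visits /= !big_ord0.
have [-> _] := stepE x n (z - 1); have [_ ->] := stepE x n z.
have -> : pos (free a) x n.+1 = pos (free a) x n +
  (if a (pos (free a) x n) (visits (free a) x n (pos (free a) x n))
   then 1 else -1) by exact: posS.
move: (pos _ _ _) IH => p IH.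
move: IH; have [->|pz1] := eqVneq p (z - 1).
  by case: (a _ _) => /=; lia.
have [->|pz] := eqVneq p z; first by case: (a z _) => /=; lia.
by case: (a p _) => /=; lia.
Qed.

(** Conservation at a site: arrivals from both neighbours and the start balance departures and the
    present position. It follows from [flow] on the two edges at [z]. *)
Let entries x n (z : int) :
  (R (z - 1) (visits (free a) x n (z - 1)) +
   L (z + 1) (visits (free a) x n (z + 1)) + (x == z) =
   visits (free a) x n z + (pos (free a) x n == z))%N.
Proof.
have := flow x n z; have := flow x n (z + 1).
have -> : z + 1 - 1 = z by ring.
by have := RLE z (visits (free a) x n z); lia.
Qed.

(** At each time, the arrows consumed by the walk from 1 are among those eventually consumed by the
    walk from 0 ([key]). As the latter visits each site finitely often and is bounded below, so does
    and is the former, which must then escape to the right. *)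
Lemma transient_succ : transient a 0 -> transient a 1.
Proof.
move=> tr.
have key n : exists N, forall z,
    (visits (free a) 1 n z <= visits (free a) 0 N z)%N.
  elim: n => [|n [N0 hN0]]; first by exists 0%N.
  set z := pos (free a) 1 n.
  have [n0 h0] := tr (Num.max z 1).
  pose N := maxn N0 n0.
  have hN y : (visits (free a) 1 n y <= visits (free a) 0 N y)%N.
    by apply: leq_trans (hN0 y) _; apply: visits_le; rewrite leq_maxl.
  have pN : Num.max z 1 < pos (free a) 0 N by apply: h0; rewrite leq_maxr.
  exists N => y; rewrite visitsS -/z; case: eqP => [<-{y}|_]; last by rewrite addn0.
  (* If both walks had consumed equally many arrows at [z], the walk from 0, having left [z], would
     have too few arrivals at [z], although by monotonicity it has at least those of the walk from
     1. *)
  rewrite addn1 ltn_neqAle hN andbT; apply/negP => /eqP E.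
  have := entries 0 N z; have := entries 1 n z; rewrite -/z eqxx.
  have := R_le (z - 1) (hN (z - 1)); have := L_le (z + 1) (hN (z + 1)).
  have -> : (pos (free a) 0 N == z) = false by lia.
  (* At [z = 1] the start of the walk from 1 hides the missing unit. The flow over the edge from 0
     to 1 restores it: the walk from 0 has crossed it once more to the right than to the left. *)
  case: (eqVneq 1 z) => z1; last by case: (0 == z) => /=; lia.
  move: E; rewrite -z1 subrr => E.
  have := flow 0 N 1; have := flow 1 n 1; rewrite -/z -z1 subrr E.
  have -> : (1 <= pos (free a) 0 N) by lia.
  by case: (0 == 1) => /=; lia.
have vis_bounded z : exists B, forall n, (visits (free a) 1 n z <= B)%N.
  have [n0 h0] := tr z.
  exists (visits (free a) 0 n0 z) => n; have [N hN] := key n.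
  apply: leq_trans (hN z) _.
  have [Nn|/subnKC <-] := leqP N n0; first exact: visits_le.
  elim: (_ - _)%N => [|k IH]; first by rewrite addn0 visitsS; have := h0 n0 (leqnn _); case: eqP; lia.
  by rewrite addnS visitsS; have := h0 (n0.+1 + k)%N; case: eqP; lia.
have lb : exists l : nat, forall n, - l%:Z <= pos (free a) 0 n.
  have [n0 h0] := tr 0.
  exists n0 => n.
  have [nn|nn] := leqP n0 n; first by have := h0 n nn; lia.
  suff : - n%:Z <= pos (free a) 0 n by lia.
  elim: {nn} n => [//|n IH]; have := free_step a 0 n; lia.
move=> K; have [l hl] := lb.
(* A visit of the walk from 1 below [-l] would be matched by one of the walk from 0. *)
have lb1 n : - l%:Z <= pos (free a) 1 n.
  rewrite leNgt; apply/negP => h; have [N hN] := key n.+1.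
  have := hN (pos (free a) 1 n); rewrite visitsS eqxx addn1.
  suff -> : visits (free a) 0 N (pos (free a) 1 n) = 0%N by [].
  elim: N {hN} => [//|N IH]; rewrite visitsS IH.
  by have := hl N; case: eqP; lia.
(* From some time on, the walk from 1 avoids every site of the range from [-l] to |K|; with the
   lower bound [-l], only sites above [K] remain. *)
have [n0 hn0] : exists n0, forall n, (n0 <= n)%N -> forall i : nat,
    (i <= `|K| + l)%N -> pos (free a) 1 n != i%:Z - l%:Z.
  elim: (`|K| + l)%N => [|m [n0 h0]].
    have [B /eventually_neq [n0 h0]] := vis_bounded (0%N%:Z - l%:Z).
    by exists n0 => n nn0 i; rewrite leqn0 => /eqP ->; exact: h0.
  have [B /eventually_neq [n1 h1]] := vis_bounded (m.+1%:Z - l%:Z).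
  exists (maxn n0 n1) => n nn i.
  rewrite leq_eqVlt => /predU1P[->|il]; first by apply: h1; lia.
  by apply: h0; lia.
exists n0 => n nn; rewrite ltNge; apply/negP => pK.
have := lb1 n => pl.
have il : (`|(pos (free a) 1 n + l%:Z)%R| <= `|K| + l)%N by lia.
have := hn0 n nn _ il; lia.
Qed.

End Abelian.

(** * Birkhoff's theorem *)

Section Ergodic.
Context d (S : measurableType d) (R : realType) (Q : probability S R).
Variable tau : S -> S.

Definition preserving := measurable_fun setT tau /\
  forall A, measurable A -> Q (tau @^-1` A) = Q A.

Definition ergodic_map := forall A, measurable A -> tau @^-1` A = A ->
  Q A = 0%E \/ Q A = 1%E.

Lemma probability1_ae (A : set S) : measurable A -> Q A = 1%E ->
  {ae Q, forall s, A s}.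
Proof.
move=> mA QA; exists (~` A); split => //; first exact: measurableC.
by rewrite probability_setC// QA subee.
Qed.

Lemma ae_probability1 (A : set S) : measurable A -> {ae Q, forall s, A s} ->
  Q A = 1%E.
Proof.
move=> mA hA; have h : Q (~` A) = 0%E by apply/negligibleP => //; exact: measurableC.
rewrite probability_setC// in h; have : (1 - Q A + Q A = 0 + Q A)%E by rewrite [X in (X + _)%E]h.
by rewrite subeK ?add0e// fin_num_measure.
Qed.

Hypothesis ptau : preserving.

Let mtau : measurable_fun setT tau := ptau.1.

Lemma ge0_integral_preserving (f : S -> \bar R) : measurable_fun setT f ->
  (forall s, 0 <= f s)%E -> (\int[Q]_s f (tau s) = \int[Q]_s f s)%E.
Proof.
move=> mf f0.
have -> : (\int[Q]_s f (tau s) = \int[Q]_(s in tau @^-1` setT) (f \o tau) s)%E.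
  by rewrite preimage_setT.
rewrite -ge0_integral_pushforward//.
pose t : {mfun S >-> S} := HB.pack tau (isMeasurableFun.Build _ _ _ _ _ mtau).
by apply: (@eq_measure_integral _ _ _ setT Q (pushforward Q t)) => A mA _; rewrite /= /pushforward/=; exact: ptau.2.
Qed.

Lemma measurable_iter n : measurable_fun setT (iter n tau).
Proof.
elim: n => [|n IH]; first exact: measurable_id.
exact: measurableT_comp mtau IH.
Qed.

Lemma preserving_iter n A : measurable A -> Q (iter n tau @^-1` A) = Q A.
Proof.
move=> mA; elim: n => [//|n <-].
have mn : measurable (iter n tau @^-1` A).
  by rewrite -(setTI (_ @^-1` _)); exact: measurable_iter.
rewrite -(ptau.2 _ mn); congr (Q _).
by apply/seteqP; split => s; rewrite /preimage /= -iterSr.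
Qed.

Lemma ae_iter (A : set S) : {ae Q, forall s, A s} ->
  {ae Q, forall s, forall n, A (iter n tau s)}.
Proof.
move=> [B [mB QB AB]]; apply: ae_foralln => n.
exists (iter n tau @^-1` B); split.
- by rewrite -(setTI (_ @^-1` _)); exact: measurable_iter.
- exact: etrans (preserving_iter n mB) QB.
- by move=> s /= h; apply: AB.
Qed.

Hypothesis etau : ergodic_map.

(* Garsia's maximal process: [maxsum g n s] is the maximum of 0 and of the
   Birkhoff sums of [g] up to time [n]. *)
Fixpoint maxsum (g : S -> R) (n : nat) (s : S) : R :=
  if n is m.+1 then Num.max 0 (g s + maxsum g m (tau s)) else 0.

Let maxsum_ge0 g n s : 0 <= maxsum g n s.
Proof. by case: n => [//|n]; rewrite /= le_max lexx. Qed.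

Let maxsum_ge g n s : \sum_(i < n) g (iter i tau s) <= maxsum g n s.
Proof.
elim: n s => [|n IH] s; first by rewrite big_ord0.
rewrite big_ord_recl /= le_max; apply/orP; right; rewrite lerD2l.
apply: le_trans (IH (tau s)).
by rewrite le_eqVlt; apply/orP; left; apply/eqP; apply: eq_bigr => i _; rewrite -iterSr.
Qed.

Let maxsumS g n s : maxsum g n s <= maxsum g n.+1 s.
Proof.
elim: n s => [|n IH] s; first exact: maxsum_ge0.
rewrite [leRHS]/= [leLHS]/=.
have := IH (tau s); set x := maxsum g n _; set y := maxsum g n.+1 _ => xy.
by rewrite ge_max !le_max lexx /= lerD2l xy orbT.
Qed.

Let maxsum_le g n m s : (n <= m)%N -> maxsum g n s <= maxsum g m s.
Proof.
move=> /subnKC <-; elim: (_ - _)%N => [|k IH]; first by rewrite addn0.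
by rewrite addnS (le_trans IH).
Qed.

Section Birkhoff.
Variable g : S -> R.
Hypothesis ig : Q.-integrable setT (EFin \o g).
Hypothesis g_lt0 : (\int[Q]_s (g s)%:E < 0)%E.

Let mg : measurable_fun setT g.
Proof. by apply/measurable_EFinP; exact: measurable_int ig. Qed.

Let mmaxsum n : measurable_fun setT (maxsum g n).
Proof.
elim: n => [|n IH]; first exact: measurable_cst.
apply: measurable_maxr; first exact: measurable_cst.
by apply: measurable_funD => //; exact: measurableT_comp IH mtau.
Qed.

Let imaxsum_tau n : Q.-integrable setT (EFin \o maxsum g n) ->
  Q.-integrable setT (EFin \o (maxsum g n \o tau)).
Proof.
move=> h; apply/integrableP; split.
  by apply/measurable_EFinP; exact: measurableT_comp (mmaxsum n) mtau.
rewrite (_ : (fun _ => _) = fun s => `|(maxsum g n (tau s))%:E|%E)//.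
rewrite (ge0_integral_preserving (f := fun s => `|(maxsum g n s)%:E|%E)).
- by move/integrableP : h => [].
- by apply: measurableT_comp => //; exact/measurable_EFinP.
- by move=> s; exact: abse_ge0.
Qed.

Let imaxsum n : Q.-integrable setT (EFin \o maxsum g n).
Proof.
elim: n => [|n IH].
  by apply: (eq_integrable _ (cst 0%E)) => //; exact: integrable0.
have ige := integrableD measurableT ig (imaxsum_tau IH).
apply: (le_integrable measurableT _ _ ige); first by apply/measurable_EFinP.
move=> s _ /=; rewrite lee_fin.
rewrite ger0_norm ?le_max ?lexx//.
by rewrite ge_max normr_ge0 ler_norm.
Qed.

Let A := [set s | forall C : nat, exists n, C%:R < maxsum g n s].

Let mA : measurable A.
Proof.
have -> : A = \bigcap_C \bigcup_n [set s | C%:R < maxsum g n s].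
  apply/seteqP; split => [s h C _|s h C].
    by have [n hn] := h C; exists n.
  by have [n _ hn] := h C I; exists n.
apply: bigcapT_measurable => C; apply: bigcupT_measurable => n.
have : measurable_fun setT (fun s => C%:R < maxsum g n s) by exact: measurable_fun_ltr.
by move=> /(_ measurableT [set true]); rewrite setTI; apply.
Qed.

(** [maxsum g n.+1 s] is 0 or [g s + maxsum g n (tau s)], so unboundedness at [s] and at [tau s] are
    equivalent; |g s| is absorbed in the level [C]. *)
Let A_inv : tau @^-1` A = A.
Proof.
apply/seteqP; split => s /= h C.
- have [n hn] := h (C + Num.truncn `|g s|).+1%N.
  exists n.+1; rewrite /= lt_max; apply/orP; right.
  have := truncnS_gt `|g s|; move: hn.
  rewrite -addnS natrD; have : - `|g s| <= g s by rewrite lerNl ler_normr lexx orbT.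
  by lra.
- have [n hn] := h (C + Num.truncn `|g s|).+1%N.
  case: n hn => [|n]; first by rewrite /= ltNge ler0n.
  rewrite /= lt_max => /orP[|hn]; first by rewrite ltNge ler0n.
  exists n; have := truncnS_gt `|g s|; move: hn.
  rewrite -addnS natrD; have : g s <= `|g s| by exact: ler_norm.
  by lra.
Qed.

(** The increments [h n] equal the maximum of [g] and [- maxsum g n (tau s)]. On [A] they eventually
    equal [g], and they are dominated by |g|. Their integrals are nonnegative because [maxsum]
    increases with [n] and [tau] preserves [Q]. If [A] had full measure, the integral of [g] would
    be nonnegative. *)
Let A_neq1 : Q A <> 1%E.
Proof.
move=> QA.
pose h n s := maxsum g n.+1 s - maxsum g n (tau s).
have hE n s : h n s = Num.max (- maxsum g n (tau s)) (g s).
  by rewrite /h /= addr_maxl sub0r addrK.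
have : (\int[Q]_s (h n s)%:E)%E @[n --> \oo] --> (\int[Q]_s (g s)%:E)%E.
  have [|||||_ _] := @dominated_convergence _ _ _ Q setT measurableT
    (fun n s => (h n s)%:E) (EFin \o g) (abse \o (EFin \o g)).
  - move=> n; apply/measurable_EFinP; apply: measurable_funB => //.
    exact: measurableT_comp (mmaxsum n) mtau.
  - exact/measurable_EFinP.
  - have := probability1_ae mA QA; apply: filterS => s As _.
    apply: cvg_near_cst.
    have : A (tau s) by rewrite -[A (tau s)]/((tau @^-1` A) s) A_inv.
    move=> /(_ (Num.truncn `|g s|).+1) [n hn].
    exists n => // m /= nm; rewrite hE; congr EFin; apply/max_idPr.
    have := maxsum_le g (tau s) nm; have := truncnS_gt `|g s|.
    have : - g s <= `|g s| by rewrite ler_normr lexx orbT.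
    by move: hn; lra.
  - exact: integrable_abse.
  - apply: aeW => s n _ /=; rewrite lee_fin hE.
    have := maxsum_ge0 g n (tau s); set M := maxsum _ _ _ => M0.
    have [gM|Mg] := leP (- M) (g s) => //.
    rewrite normrN ger0_norm//.
    by rewrite ler_normr; apply/orP; right; lra.
  - by apply.
move=> hg; suff /cvge_ge-/(_ _ hg) : (\forall n \near \oo, 0 <= \int[Q]_s (h n s)%:E)%E.
  by rewrite leNgt g_lt0.
apply: nearW => n; rewrite /h; under eq_integral do rewrite EFinB.
rewrite integralB//; [|exact: imaxsum|exact/imaxsum_tau/imaxsum].
rewrite (ge0_integral_preserving (f := EFin \o maxsum g n)).
- rewrite sube_ge0; last by rewrite integrable_fin_num.
  apply: (le_integral measurableT (imaxsum n) (imaxsum n.+1)).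
  by move=> s _; rewrite lee_fin maxsumS.
- exact/measurable_EFinP.
- by move=> s; rewrite lee_fin.
Qed.

Lemma maxsum_bounded : {ae Q, forall s, exists C : R, forall n,
  \sum_(i < n) g (iter i tau s) <= C}.
Proof.
have [QA|/A_neq1//] := etau mA A_inv.
exists A; split => // s /= hs C; apply: contrapT => h; apply: hs.
exists C%:R => n; rewrite (le_trans (maxsum_ge _ _ _))//.
by rewrite leNgt; apply/negP => hn; apply: h; exists n.
Qed.

End Birkhoff.

(** [f - c] has negative mean, so its Birkhoff sums are bounded above. This one-sided form, with an
    additive constant depending on the point, is how the ergodic theorem is used; lower bounds come
    from [- f]. *)
Lemma birkhoff_le (f : S -> R) (c : R) : Q.-integrable setT (EFin \o f) ->
  (\int[Q]_s (f s)%:E < c%:E)%E ->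
  {ae Q, forall s, exists C : R, forall n : nat,
    \sum_(i < n) f (iter i tau s) <= c * n%:R + C}.
Proof.
move=> fi fc.
have ic : Q.-integrable setT (EFin \o cst c) by exact: finite_measure_integrable_cst.
have := @maxsum_bounded (fun s => f s - c).
have ifc : Q.-integrable setT (EFin \o (fun s => f s - c)).
  by apply: eq_integrable (integrableB measurableT fi ic).
move=> /(_ ifc) h; have /h : (\int[Q]_s (f s - c)%:E < 0)%E.
  under eq_integral do rewrite EFinB.
  rewrite integralB//= integral_cst//.
  rewrite [X in (_ - _ * X)%E](_ : _ = 1%E); last exact: probability_setT.
  by rewrite mule1 suber_lt0.
apply: filterS => s [C hC]; exists C => n; have := hC n.
by rewrite sumrB sumr_const card_ord -[c *+ n]mulr_natr lerBlDl.
Qed.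

(** The Birkhoff sums of an invariant [f] are [n * f s], which outgrow [c * n + C] as soon as
    [f s > c]; let [c] decrease to the mean. *)
Lemma ae_le_of_invariant (f : S -> R) : Q.-integrable setT (EFin \o f) ->
  (forall s, f (tau s) = f s) ->
  {ae Q, forall s, f s <= fine (\int[Q]_s (f s)%:E)%E}.
Proof.
move=> fi finv; set m := fine _.
have mE : (\int[Q]_s (f s)%:E)%E = m%:E.
  by rewrite fineK// (integrable_fin_num measurableT fi).
have fit s i : f (iter i tau s) = f s by elim: i => [//|i IH]; rewrite iterS finv.
have : {ae Q, forall s, forall n : nat, f s <= m + n.+1%:R^-1}.
  apply: ae_foralln => n.
  have : (\int[Q]_s (f s)%:E < (m + n.+1%:R^-1)%:E)%E by rewrite mE lte_fin ltrDl.
  move=> /(birkhoff_le fi); apply: filterS => s [C hC].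
  rewrite leNgt; apply/negP => hm.
  have e0 : 0 < f s - (m + n.+1%:R^-1) by rewrite subr_gt0.
  (* A time [n] with [n * (f s - c) > C]. *)
  have := hC (Num.truncn (C / (f s - (m + n.+1%:R^-1)))).+1.
  under eq_bigr do rewrite fit.
  rewrite sumr_const card_ord -[f s *+ _]mulr_natr -lerBlDl -mulrBl leNgt => /negP; apply.
  by rewrite mulrC -ltr_pdivrMr// truncnS_gt.
apply: filterS => s h; apply/ler_addgt0Pr => e e0.
have /= := h (Num.truncn e^-1); move=> /le_trans; apply; rewrite lerD2l.
by rewrite invf_ple ?posrE// ltW// truncnS_gt.
Qed.

Lemma ae_const (f : S -> R) : Q.-integrable setT (EFin \o f) ->
  (forall s, f (tau s) = f s) ->
  {ae Q, forall s, f s = fine (\int[Q]_s (f s)%:E)%E}.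
Proof.
move=> fi finv.
have fNi : Q.-integrable setT (EFin \o (fun s => - f s)).
  by have := integrableN fi; rewrite /comp; under eq_fun do rewrite -EFinN.
have := ae_le_of_invariant fNi (fun s => congr1 -%R (finv s)).
have -> : (\int[Q]_s (- f s)%:E = - \int[Q]_s (f s)%:E)%E.
  by under eq_integral do rewrite EFinN; rewrite integralN// integrable_add_def.
rewrite fineN; move: (ae_le_of_invariant fi finv); apply: filterS2 => s h1 h2.
by apply/eqP; rewrite eq_le h1 -lerN2 h2.
Qed.

End Ergodic.

(** * Measures on function spaces *)

(** For countable [V], such as [bool] and [int] below, these sets generate the product of the
    discrete sigma-algebras. *)
Definition coord_sets (I : Type) (V : pointedType) : set (set (I -> V)) :=
  [set A | exists i v, A = [set f | f i = v]].

Definition fspace (I : Type) (V : pointedType) :=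
  g_sigma_algebraType (@coord_sets I V).

Definition cylinder (I : eqType) (V : Type) (s : seq I) (v : I -> V) :
  set (I -> V) := [set f | forall i, i \in s -> f i = v i].

Lemma probability_unique d (T : measurableType d) (R : realType)
    (G : set (set T)) (P1 P2 : probability T R) :
  @measurable _ T = <<s G >> -> setI_closed G -> G setT ->
  (forall A, G A -> P1 A = P2 A) -> forall A, measurable A -> P1 A = P2 A.
Proof.
move=> mG GI GT P12 A mA.
apply: (measure_unique G (fun=> setT)) => //.
- by rewrite bigcup_const.
- by move=> _; apply: le_lt_trans (probability_le1 _ _) (ltry _).
Qed.

Lemma probability_setI1 d (T : measurableType d) (R : realType)
    (P : probability T R) (A E : set T) :
  measurable A -> measurable E -> P E = 1%E -> P (A `&` E) = P A.
Proof.
move=> mA mE PE; apply/eqP; rewrite eq_le; apply/andP; split.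
  by apply: le_measure; rewrite ?inE//; exact: measurableI.
have mCE := measurableC mE.
rewrite -{1}(setIT A) -(setUv E) setIUr.
apply: le_trans (measureU2 _ _ _) _; [exact: measurableI|exact: measurableI|].
rewrite -[leRHS]adde0 leeD2l//.
apply: le_trans (_ : P (~` E) <= _)%E.
  by apply: le_measure; rewrite ?inE//; exact: measurableI.
by rewrite probability_setC// PE subee.
Qed.

(** * Asymptotic independence extended from a generating class *)

Section Decorrelation.
Context d (T : measurableType d) (R : realType) (P : probability T R).

Let pr (A : set T) : R := fine (P A).

Let PE A : measurable A -> P A = (pr A)%:E.
Proof. by move=> mA; rewrite /pr fineK// fin_num_measure. Qed.

Let pr_le A B : measurable A -> measurable B -> A `<=` B -> pr A <= pr B.
Proof.
move=> mA mB AB; rewrite -lee_fin -!PE//.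
by apply: le_measure; rewrite ?inE.
Qed.

Let pr_setU A B : measurable A -> measurable B -> A `&` B = set0 ->
  pr (A `|` B) = pr A + pr B.
Proof.
move=> mA mB AB; apply: EFin_inj; rewrite EFinD -!PE//; last exact: measurableU.
exact: measureU.
Qed.

Let pr_setC A : measurable A -> pr (~` A) = 1 - pr A.
Proof.
move=> mA; apply: EFin_inj; rewrite -PE; last exact: measurableC.
by rewrite probability_setC// EFinB -PE.
Qed.

(** The sets whose correlation with [B m] vanishes in the limit form a Dynkin class. The sequence
    [B] need not converge: it is used with far translates of a cylinder, and with a constant
    sequence. *)
Lemma decorrelation (G : set (set T)) (B : nat -> set T) :
  @measurable _ T = <<s G >> -> setI_closed G -> (forall m, measurable (B m)) ->
  (forall A, G A -> exists m0, forall m, (m0 <= m)%N ->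
     P (A `&` B m) = (P A * P (B m))%E) ->
  forall A, measurable A ->
    fine (P (A `&` B m)) - fine (P A) * fine (P (B m)) @[m --> \oo] --> (0 : R).
Proof.
move=> GE GI mB GB.
pose small A := forall e, 0 < e -> exists m0, forall m, (m0 <= m)%N ->
  `|pr (A `&` B m) - pr A * pr (B m)| <= e.
have GM A : G A -> measurable A by rewrite GE => GA; exact: sub_sigma_algebra.
have prB01 m : 0 <= pr (B m) <= 1.
  by rewrite -!lee_fin -PE// measure_ge0 probability_le1.
have small_split A C : measurable A -> measurable C -> A `&` C = set0 ->
    small A -> small C -> small (A `|` C).
  move=> mA mC AC sA sC e e0.
  have e20 : 0 < e / 2 by rewrite divr_gt0.
  have [m0 h0] := sA _ e20; have [m1 h1] := sC _ e20.
  exists (maxn m0 m1) => m; rewrite geq_max => /andP[m0m m1m].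
  rewrite setIUl !pr_setU//; [|exact: measurableI|exact: measurableI|]; last first.
    by rewrite setIACA AC set0I.
  have := h0 m m0m; have := h1 m m1m; rewrite !ler_norml.
  set x := pr (A `&` _); set y := pr (C `&` _); set z := pr A; set t := pr C.
  by rewrite mulrDl; lra.
suff key A : <<s G >> A -> small A.
  move=> A; rewrite GE => /key hA; apply/cvgrPdist_le => e e0.
  have [m0 h0] := hA e e0; exists m0 => // m mm.
  by rewrite sub0r normrN; exact: h0.
move: A; apply: dynkin_induction => //.
- move=> e e0; exists 0%N => m _; rewrite setTI /pr probability_setT mul1r subrr normr0.
  exact: ltW.
- move=> A GA e e0; have [m0 h0] := GB _ GA; exists m0 => m mm.
  rewrite {1}/pr h0// PE ?(PE (mB m)) /= ?subrr ?normr0; [exact: ltW|exact: GM].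
- move=> A mA sA e e0; have [m0 h0] := sA e e0; exists m0 => m mm.
  have -> : pr (~` A `&` B m) = pr (B m) - pr (A `&` B m).
    have mAB : measurable (A `&` B m) by exact: measurableI.
    have mCAB : measurable (~` A `&` B m).
      by apply: measurableI => //; exact: measurableC.
    have e1 : (A `&` B m) `|` (~` A `&` B m) = B m by rewrite -setIUl setUv setTI.
    have e2 : (A `&` B m) `&` (~` A `&` B m) = set0 by rewrite setIACA setICr set0I.
    by have := pr_setU mAB mCAB e2; rewrite e1 => ->; rewrite addrC addKr.
  by rewrite pr_setC// mulrBl mul1r opprB addrC addrA addrNK distrC; exact: h0.
- move=> F mF tF sF e e0.
  pose U N : set T := [set x | exists2 k, (k < N)%N & F k x].
  have US N : U N.+1 = U N `|` F N.
    apply/seteqP; split => x /=.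
      move=> [k]; rewrite ltnS leq_eqVlt => /predU1P[->|kN] Fk; first by right.
      by left; exists k.
    by move=> [[k kN Fk]|FN]; [exists k => //; exact: ltnW|exists N].
  have U0 : U 0%N = set0 by apply/seteqP; split => x // [].
  have mU N : measurable (U N).
    by elim: N => [|N IH]; rewrite ?U0 ?US; [exact: measurable0|exact: measurableU].
  have sU N : small (U N).
    elim: N => [|N IH].
      rewrite U0 => e' e'0; exists 0%N => m _.
      by rewrite set0I /pr measure0 mul0r subrr normr0 ltW.
    rewrite US; apply: small_split => //.
    apply/seteqP; split => x // [[k kN Fk] FN].
    have kN' : k = N by apply: (tF k N) => //; exists x.
    by move: kN; rewrite kN' ltnn.
  have bU : \bigcup_N U N = \bigcup_k F k.
    apply/seteqP; split => x; first by move=> [N _ [k kN Fk]]; exists k.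
    by move=> [k _ Fk]; exists k.+1 => //; exists k.
  have mFU : measurable (\bigcup_k F k) by exact: bigcupT_measurable.
  have [N hN] : exists N, pr (\bigcup_k F k) - pr (U N) <= e / 3.
    have e30 : 0 < e / 3 by rewrite divr_gt0.
    have : pr (U N) @[N --> \oo] --> pr (\bigcup_k F k).
      apply: fine_cvg; rewrite -PE//.
      rewrite -bU; apply: nondecreasing_cvg_mu => //; first by rewrite bU.
      move=> n n' nn'; apply/subsetPset => x [k kn Fk]; exists k => //.
      exact: leq_trans nn'.
    move=> /cvgrPdist_le/(_ _ e30)[N _ hN]; exists N.
    by apply: le_trans (hN N _) => //=; exact: ler_norm.
  have e30 : 0 < e / 3 by rewrite divr_gt0.
  have [m0 h0] := sU N _ e30; exists m0 => m mm.
  have UF : U N `<=` \bigcup_k F k by rewrite -bU => x UN; exists N.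
  (* The tail [W] has probability at most [e / 3], so it changes the joint probability and the
     product by at most [e / 3] each. *)
  set W := (\bigcup_k F k) `\` U N.
  have mW : measurable W by exact: measurableD.
  have WE : \bigcup_k F k = U N `|` W by rewrite setDUK.
  have disj : U N `&` W = set0 by rewrite /W setDE setICA setICr setI0.
  have prW : pr W <= e / 3 by move: hN; rewrite {1}WE pr_setU//; lra.
  have prWB : 0 <= pr (W `&` B m) <= e / 3.
    apply/andP; split; first by rewrite fine_ge0.
    by apply: le_trans prW; apply: pr_le => //; exact: measurableI.
  have prW0 : 0 <= pr W by rewrite fine_ge0.
  have := h0 m mm; rewrite WE setIUl !pr_setU//; [|exact: measurableI|exact: measurableI|]; last first.
    by rewrite setIACA disj set0I.
  have : 0 <= pr W * pr (B m) <= pr W.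
    have /andP[b0 b1] := prB01 m.
    by rewrite mulr_ge0//= -[leRHS]mulr1; exact: ler_wpM2l.
  rewrite !ler_norml mulrDl; move: (pr (U N `&` _)) (pr (U N) * _) (pr W * _) => x y z.
  by lra.
Qed.

End Decorrelation.

Section FunctionSpace.
Context (I : eqType) (V : pointedType) (R : realType).

Lemma measurable_coord (i : I) (v : V) :
  measurable ([set f | f i = v] : set (fspace I V)).
Proof. by apply: sub_sigma_algebra; exists i, v. Qed.

Lemma measurable_fspace d (T : measurableType d) (X : T -> fspace I V) :
  (forall i v, measurable [set t | X t i = v]) -> measurable_fun setT X.
Proof.
move=> h; apply: (@measurability _ _ T (fspace I V) setT X (@coord_sets I V)) => //.
by move=> _ [_ [i [v ->]] <-]; rewrite setTI; exact: h.
Qed.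

Lemma measurable_cylinder (s : seq I) (v : I -> V) :
  measurable (cylinder s v : set (fspace I V)).
Proof.
elim: s => [|i s IH].
  by rewrite (_ : cylinder _ _ = setT)//; apply/seteqP; split.
rewrite (_ : cylinder _ _ = [set f | f i = v i] `&` cylinder s v).
  by apply: measurableI => //; exact: measurable_coord.
apply/seteqP; split => [f h|f [fi h] j].
  split => [|j js]; first by apply: h; rewrite inE eqxx.
  by apply: h; rewrite inE js orbT.
by rewrite inE => /predU1P[->//|]; exact: h.
Qed.

(** The empty set is included because two cylinders may disagree on a common coordinate; coordinates
    are not repeated so that product formulas apply. *)
Definition cylinders : set (set (fspace I V)) :=
  [set A | A = set0 \/ exists s v, uniq s /\ A = cylinder s v].

(** Any point of a nonempty intersection supplies the common prescribed values. *)
Lemma cylinders_setI : setI_closed cylinders.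
Proof.
move=> A B [->|[s [v [us ->]]]]; first by rewrite set0I; left.
move=> [->|[s' [v' [us' ->]]]]; first by rewrite setI0; left.
have [[f [fs fs']]|nf] := EM ((cylinder s v `&` cylinder s' v') !=set0).
  right; exists (undup (s ++ s')), f; split; first exact: undup_uniq.
  apply/seteqP; split => [g [gs gs'] i|g gf].
    rewrite mem_undup mem_cat => /orP[is_|is_].
      by rewrite gs// fs.
    by rewrite gs'// fs'.
  split => i is_.
    by rewrite gf ?fs// mem_undup mem_cat is_.
  by rewrite gf ?fs'// mem_undup mem_cat is_ orbT.
by left; apply/seteqP; split => // f hf; apply: nf; exists f.
Qed.

Lemma cylindersT : cylinders setT.
Proof.
right; exists [::], (fun=> point); split => //.
by apply/seteqP; split.
Qed.

Lemma cylindersE : @measurable _ (fspace I V) = <<s cylinders >>.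
Proof.
apply/seteqP; split.
  apply: smallest_sub; first exact: smallest_sigma_algebra.
  move=> _ [i [v ->]]; apply: sub_sigma_algebra; right.
  exists [:: i], (fun=> v); split => //.
  apply/seteqP; split => [f fi j|f fv]; last by apply: fv; rewrite inE.
  by rewrite inE => /eqP ->.
apply: smallest_sub; first exact: sigma_algebra_measurable.
by move=> _ [->|[s [v [_ ->]]]]; [exact: measurable0|exact: measurable_cylinder].
Qed.

Lemma fspace_unique (P1 P2 : probability (fspace I V) R) :
  (forall s v, uniq s -> P1 (cylinder s v) = P2 (cylinder s v)) ->
  forall A, measurable A -> P1 A = P2 A.
Proof.
move=> h; apply: (probability_unique cylindersE cylinders_setI cylindersT).
by move=> A [->|[s [v [us ->]]]]; [rewrite !measure0|exact: h].
Qed.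

End FunctionSpace.

Lemma measurable_forall_lt d (Z : measurableType d) n (G : nat -> Z -> bool) :
  (forall i, measurable_fun setT (G i)) ->
  measurable [set z | forall i, (i < n)%N -> G i z].
Proof.
move=> mG.
rewrite (_ : [set _ | _] = \bigcap_i (if (i < n)%N then G i @^-1` [set true] else setT)).
  apply: bigcapT_measurable => i; case: ifP => // _.
  by rewrite -[X in measurable X]setTI; exact: mG.
apply/seteqP; split => [z h i _|z h i ni]; first by case: ifP => // ni; exact: h.
by have := h i I; rewrite ni.
Qed.

(** * Independent bits from one uniform variable *)

Section Splitting.
Variable R : realType.

(* A uniform point [u] of [[l, r[] is turned into independent bits of means
   [p 0, p 1, ...] by repeatedly cutting the current interval. *)
Fixpoint split_bit (p : nat -> R) (l r u : R) (i : nat) : bool :=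
  let m := l + (r - l) * p 0%N in
  if i is j.+1 then
    if u < m then split_bit (p \o S) l m u j else split_bit (p \o S) m r u j
  else u < m.

Lemma measurable_split_bit d (Z : measurableType d) (p : Z -> nat -> R)
    (l r u : Z -> R) i : (forall j, measurable_fun setT (fun z => p z j)) ->
  measurable_fun setT l -> measurable_fun setT r -> measurable_fun setT u ->
  measurable_fun setT (fun z => split_bit (p z) (l z) (r z) (u z) i).
Proof.
elim: i p l r => [|i IH] p l r mp ml mr mu /=;
  have mm : measurable_fun setT (fun z => l z + (r z - l z) * p z 0%N)
    by apply: measurable_funD => //; apply: measurable_funM => //; exact: measurable_funB.
  exact: measurable_fun_ltr.
apply: measurable_fun_ifT; first exact: measurable_fun_ltr.
- by apply: (IH (fun z => p z \o S)) => // j; exact: mp.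
- by apply: (IH (fun z => p z \o S)) => // j; exact: mp.
Qed.

Definition lam01 : probability (measurableTypeR R) R := uniform_prob (@ltr01 R).

Lemma lam01_itv (l r : R) : 0 <= l -> l <= r -> r <= 1 ->
  lam01 [set u | l <= u < r] = (r - l)%:E.
Proof.
move=> l0 lr r1; rewrite /lam01 /= /uniform_prob integral_uniform_pdf.
rewrite (_ : [set u | l <= u < r] = `[l, r[%classic); last first.
  by apply/seteqP; split => u /=; rewrite in_itv.
rewrite setIidl; last first.
  by move=> u /=; rewrite !in_itv /= => /andP[lu ur]; lra.
rewrite (eq_integral (cst 1%E)); last first.
  move=> u; rewrite inE /= in_itv /= /uniform_pdf => /andP[lu ur].
  by rewrite ifT ?subr0 ?invr1//; lra.
rewrite integral_cst// mul1e.
apply: (eq_trans (lebesgue_measure_itv `[l, r[)); rewrite /= lte_fin.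
by case: ltgtP lr => // -> _; rewrite subrr.
Qed.

Definition bit_prob (p : R) (b : bool) : R := if b then p else 1 - p.

(** The first bit cuts the interval into pieces of lengths [(r - l) * p 0] and
    [(r - l) * (1 - p 0)], and the induction hypothesis applies on each. A test [F i] may accept
    both values, which leaves the bit [i] free. *)
Lemma split_law (n : nat) (p : nat -> R) (l r : R) (F : nat -> bool -> bool) :
  (forall i, 0 <= p i <= 1) -> 0 <= l -> l <= r -> r <= 1 ->
  lam01 [set u | l <= u < r /\ forall i, (i < n)%N -> F i (split_bit p l r u i)] =
  ((r - l) * \prod_(i < n) ((F i true)%:R * p i + (F i false)%:R * (1 - p i)))%:E.
Proof.
elim: n p l r F => [|n IH] p l r F hp l0 lr r1.
  rewrite big_ord0 mulr1 -lam01_itv//; congr (lam01 _).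
  by apply/seteqP; split => u; [move=> []|split].
have /andP[p0 p1] := hp 0%N.
set m := l + (r - l) * p 0%N.
have rl : 0 <= r - l by rewrite subr_ge0.
have lm : l <= m by rewrite /m lerDl mulr_ge0.
have mr : m <= r.
  rewrite /m -lerBrDl -[leRHS]mulr1; exact: ler_wpM2l.
pose B (b : bool) (l' r' : R) : set R := [set u | l' <= u < r' /\ forall i, (i < n)%N ->
  F i.+1 (split_bit (p \o S) l' r' u i)].
have mB b l' r' : measurable (B b l' r').
  rewrite (_ : B b l' r' = [set u | l' <= u < r'] `&` [set u | forall i, (i < n)%N ->
    F i.+1 (split_bit (p \o S) l' r' u i)]); last by [].
  apply: measurableI.
    rewrite (_ : [set u | l' <= u < r'] = `[l', r'[%classic); last first.
      by apply/seteqP; split => u /=; rewrite in_itv.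
    exact: measurable_itv.
  apply: measurable_forall_lt => i; apply: (measurableT_comp (f := F i.+1)) => //.
  exact: (@measurable_split_bit _ _ (fun=> p \o S) (cst l') (cst r') id).
(* Half-open pieces make the two cases disjoint; a piece is dropped when [F 0] rejects its bit. *)
have -> : [set u | l <= u < r /\ forall i, (i < n.+1)%N -> F i (split_bit p l r u i)] =
    (if F 0%N true then B true l m else set0) `|`
    (if F 0%N false then B false m r else set0).
  apply/seteqP; split => u /=.
    move=> [/andP[lu ur] hF]; have := hF 0%N isT => /=.
    have hF' i (ni : (i < n)%N) := hF i.+1 ni.
    move: hF'; rewrite -/m; have [um|mu] := ltP u m => hF' ->; [left|right]; split.
    - by rewrite lu.
    - by move=> i ni; have := hF' i ni; rewrite /= -/m um.
    - by rewrite mu.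
    - by move=> i ni; have := hF' i ni; rewrite /= -/m ltNge mu.
  case; case: ifP => // F0 [/andP[h1 h2] hF]; split; try (apply/andP; split); try lra.
    by case=> [|i] ni /=; rewrite -/m h2//; exact: hF.
  by case=> [|i] ni /=; rewrite -/m ltNge h1//=; exact: hF.
rewrite measureU; last 3 first.
- by case: ifP => _; [exact: mB|exact: measurable0].
- by case: ifP => _; [exact: mB|exact: measurable0].
- apply/seteqP; split => // u; case: ifP => _; case: ifP => _ [] //.
  by rewrite /B /= => -[/andP[_ um] _] [/andP[mu _] _]; lra.
have lamB b l' r' : 0 <= l' -> l' <= r' -> r' <= 1 -> lam01 (if F 0%N b then B b l' r' else set0) =
    ((F 0%N b)%:R * ((r' - l') * \prod_(i < n) ((F i.+1 true)%:R * p i.+1 + (F i.+1 false)%:R * (1 - p i.+1))))%:E.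
  move=> l'0 lr' r'1; case: ifP => F0; last by rewrite measure0 mul0r.
  by rewrite mul1r (IH (p \o S) l' r' (F \o S))// => i; exact: hp.
have m1 : m <= 1 by exact: le_trans mr r1.
have m0 : 0 <= m by exact: le_trans l0 lm.
apply: eq_trans (f_equal2 adde (lamB true _ _ l0 lm m1) (lamB false _ _ m0 mr r1)) _.
apply: (congr1 (@EFin R)); rewrite big_ord_recl /= /m.
by ring.
Qed.

End Splitting.

(** * The law of the arrows *)

Section ArrowLaw.
Variable R : realType.

Definition arrow_space := fspace (int * nat)%type bool.

(** Cookies are arbitrary reals, in (0,1) only almost surely; clamping yields a probability for
    every environment. *)
Definition clamp01 (t : R) : R := Num.max 0 (Num.min 1 t).

(** The pairs (site, index) are enumerated by [pickle]; a number coding no pair gets the dummy mean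
    0. *)
Definition bit_means (w : env R) (j : nat) : R :=
  if unpickle j is Some i then clamp01 (w i.1 i.2) else 0.

(** All arrows are decoded from a single uniform variable, so the annealed law is the image of a
    product of two measures. *)
Definition arrows_of (z : Env R * measurableTypeR R) : arrow_space :=
  fun i => split_bit (bit_means z.1) 0 1 z.2 (pickle i).

Definition arrows_at (w : Env R) (u : measurableTypeR R) : arrow_space :=
  arrows_of (w, u).

Lemma clamp01_ge0_le1 t : 0 <= clamp01 t <= 1.
Proof. by rewrite /clamp01 le_max lexx ge_max ler01 ge_min lexx. Qed.

Lemma bit_means_ge0_le1 w j : 0 <= bit_means w j <= 1.
Proof.
rewrite /bit_means; case: unpickle => [i|]; first exact: clamp01_ge0_le1.
by rewrite lexx ler01.
Qed.

Lemma measurable_cookie (x : int) (c : nat) :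
  measurable_fun setT (fun w : Env R => w x c).
Proof.
move=> _ B mB; rewrite setTI; apply: sub_sigma_algebra.
by exists x, c, B.
Qed.

Lemma measurable_bit_means j : measurable_fun setT (fun w : Env R => bit_means w j).
Proof.
rewrite /bit_means; case: unpickle => [i|]; last exact: measurable_cst.
apply: measurable_maxr; first exact: measurable_cst.
by apply: measurable_minr; [exact: measurable_cst|exact: measurable_cookie].
Qed.

Lemma measurable_arrows_of : measurable_fun setT arrows_of.
Proof.
apply: measurable_fspace => i v.
have m : measurable_fun setT (fun z : Env R * measurableTypeR R => arrows_of z i).
  apply: (@measurable_split_bit R _ (Env R * measurableTypeR R)%type
    (fun z => bit_means z.1) (cst 0) (cst 1) (fun z => z.2) (pickle i)).
  - move=> j; apply: (measurableT_comp (measurable_bit_means j)).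
    exact: measurable_fst.
  - exact: measurable_cst.
  - exact: measurable_cst.
  - exact: measurable_snd.
by rewrite -[X in measurable X]setTI; apply: (m measurableT [set v]).
Qed.

Lemma measurable_arrows_at w : measurable_fun setT (arrows_at w).
Proof.
apply: (measurableT_comp measurable_arrows_of).
exact: pair1_measurable.
Qed.

HB.instance Definition _ := isMeasurableFun.Build _ _ _ _ arrows_of measurable_arrows_of.
HB.instance Definition _ w := isMeasurableFun.Build _ _ _ _ (arrows_at w) (measurable_arrows_at w).

Definition quenched (w : Env R) : probability arrow_space R :=
  distribution (lam01 R) (arrows_at w).

Definition annealed (mu : probability (Env R) R) : probability arrow_space R :=
  distribution (mu \x (lam01 R))%E arrows_of.

Lemma annealedE mu A : annealed mu A = (\int[mu]_w quenched w A)%E.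
Proof.
rewrite /annealed /= /distribution /pushforward /= /product_measure1.
apply: eq_integral => w _ /=; congr (uniform_prob _ _).
by apply/seteqP; split => u; rewrite /xsection /= inE.
Qed.

Lemma measurable_quenched A : measurable A ->
  measurable_fun setT (fun w => quenched w A).
Proof.
move=> mA.
have m : measurable (arrows_of @^-1` A).
  by rewrite -[X in measurable X]setTI; exact: measurable_arrows_of.
have := measurable_fun_xsection (lam01 R) m.
apply: eq_measurable_fun => w _ /=; congr (uniform_prob _ _).
by apply/seteqP; split => u; rewrite /xsection /= inE.
Qed.

(** Under the quenched law the arrows are independent, each pointing right with its clamped cookie
    as probability. *)
Lemma quenched_cylinder w s v : uniq s -> quenched w (cylinder s v) =
  (\prod_(i <- s) bit_prob (clamp01 (w i.1 i.2)) (v i))%:E.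
Proof.
move=> us.
pose n := (\max_(i <- s) pickle i).+1.
have sn i : i \in s -> (pickle i < n)%N by move=> is_; rewrite ltnS; exact: leq_bigmax_seq.
(* The bit [j] is tested only if [j] codes a cookie of [s]; every other bit is accepted. *)
pose F j b := all (fun i => (pickle i == j) ==> (b == v i)) s.
pose p := bit_means w.
have := @split_law R n p 0 1 F (bit_means_ge0_le1 w) (lexx _) ler01 (lexx _).
rewrite subr0 mul1r => law.
have prodE : \prod_(j < n) ((F j true)%:R * p j + (F j false)%:R * (1 - p j)) =
    \prod_(i <- s) bit_prob (clamp01 (w i.1 i.2)) (v i).
  rewrite -(big_mkord xpredT (fun j => (F j true)%:R * p j + (F j false)%:R * (1 - p j))).
  (* Factors at numbers coding no cookie of [s] equal [p + (1 - p) = 1]. *)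
  rewrite (bigID (mem (map pickle s))) /= [X in _ * X]big1 ?mulr1; last first.
    move=> j /negP js; have Fj b : F j b.
      apply/allP => i is_; apply/implyP => /eqP ij; exfalso; apply: js.
      by rewrite -ij; apply: map_f.
    by rewrite !Fj !mul1r addrC subrK.
  rewrite -big_filter (perm_big (map pickle s)); last first.
    apply: uniq_perm; first by rewrite filter_uniq// iota_uniq.
      by rewrite map_inj_uniq//; exact: (pcan_inj pickleK).
    move=> j; rewrite mem_filter mem_index_iota /= andb_idr// => /mapP[i is_ ->].
    exact: sn.
  rewrite big_map; apply: eq_big_seq => i is_.
  have Fi b : F (pickle i) b = (b == v i).
    apply/allP/eqP => [/(_ i is_)|-> k ks]; first by rewrite eqxx => /eqP.
    by apply/implyP => /eqP /(pcan_inj pickleK) ->.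
  rewrite !Fi /p /bit_means pickleK /bit_prob.
  by case: (v i) => /=; rewrite mul1r mul0r ?addr0 ?add0r.
rewrite -prodE -law /quenched /= /distribution /pushforward.
(* [split_law] concerns points of the interval from 0 included to 1 excluded, which has full
   measure. *)
rewrite -(@probability_setI1 _ _ _ (lam01 R) _ [set u | 0 <= u < 1]).
- congr (lam01 _ _); apply/seteqP; split => u /=.
    move=> [h u01]; split => // j jn; apply/allP => i is_; apply/implyP => /eqP <-.
    by rewrite -(h i is_).
  move=> [u01 h]; split => // i is_.
  by have /allP/(_ i is_) := h _ (sn i is_); rewrite eqxx /= => /eqP.
- rewrite -[X in measurable X]setTI; apply: measurable_arrows_at => //.
  exact: measurable_cylinder.
- rewrite (_ : [set u | 0 <= u < 1] = `[0, 1[%classic); last first.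
    by apply/seteqP; split => u /=; rewrite in_itv.
  exact: measurable_itv.
- by rewrite lam01_itv ?subr0.
Qed.

Lemma measurable_shift_env : measurable_fun setT (@Defs.shift R).
Proof.
apply: (@measurability _ _ (Env R) (Env R) setT _ (@cyl_sets R)) => //.
move=> _ [_ [x [c [B [mB ->]]]] <-]; rewrite setTI.
by apply: sub_sigma_algebra; exists (x + 1), c, B.
Qed.

Definition shift_arrows (a : arrow_space) : arrow_space :=
  fun i => a (i.1 + 1, i.2).

Lemma measurable_shift_arrows : measurable_fun setT shift_arrows.
Proof. by apply: measurable_fspace => i v; exact: measurable_coord. Qed.

HB.instance Definition _ :=
  isMeasurableFun.Build _ _ _ _ shift_arrows measurable_shift_arrows.

Definition shift_site (m : nat) (i : int * nat) : int * nat := (i.1 + m%:Z, i.2).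

Lemma shift_site_inj m : injective (shift_site m).
Proof. by move=> [x c] [y b] [/addIr -> ->]. Qed.

Definition unshift_site (m : nat) (i : int * nat) : int * nat := (i.1 - m%:Z, i.2).

Lemma shift_siteK m : cancel (shift_site m) (unshift_site m).
Proof. by move=> [x c]; rewrite /unshift_site /= addrK. Qed.

Lemma shift_arrows_cylinder m s v :
  iter m shift_arrows @^-1` cylinder s v =
  cylinder (map (shift_site m) s) (v \o unshift_site m).
Proof.
have itE a i : iter m shift_arrows a i = a (shift_site m i).
  elim: m i => [|m IH] i /=; first by case: i => x c; rewrite /shift_site /= addr0.
  rewrite /shift_arrows IH /shift_site /=; congr (a (_, _)).
  by rewrite -addrA; congr (_ + _); rewrite -natr1 addrC !natz.
apply/seteqP; split => a h.
  by move=> _ /mapP[i is_ ->]; rewrite /= shift_siteK -itE; exact: h.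
move=> i is_; have := h (shift_site m i) (map_f _ is_).
by rewrite itE /= shift_siteK.
Qed.

(** Both sides are probabilities in [A] with the same product formula on cylinders. *)
Lemma quenched_shift w A : measurable A ->
  quenched w (shift_arrows @^-1` A) = quenched (Defs.shift w) A.
Proof.
move: A; apply: (@fspace_unique _ _ _ (distribution (quenched w) shift_arrows) (quenched (Defs.shift w))).
move=> s v us; rewrite [RHS](quenched_cylinder (Defs.shift w) v us).
transitivity (quenched w (iter 1 shift_arrows @^-1` cylinder s v)); first by [].
rewrite (shift_arrows_cylinder 1).
have ut : uniq (map (shift_site 1) s).
  by rewrite map_inj_uniq//; exact: shift_site_inj.
rewrite (quenched_cylinder w _ ut) big_map.
by congr EFin; apply: eq_bigr => i _; rewrite /= shift_siteK.
Qed.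

End ArrowLaw.

(** * Stationarity and ergodicity of the annealed arrows *)

Section ArrowErgodic.
Context (R : realType) (mu : probability (Env R) R).
Hypotheses (smu : stationary mu) (emu : ergodic mu).

Let Q := annealed mu.

Let pmu : preserving mu (@Defs.shift R).
Proof. by split; [exact: measurable_shift_env|exact: smu]. Qed.

Lemma preserving_shift_arrows : preserving Q shift_arrows.
Proof.
split=> [|A mA]; first exact: measurable_shift_arrows.
rewrite /Q !annealedE.
transitivity (\int[mu]_w quenched (Defs.shift w) A)%E.
  by apply: eq_integral => w _; exact: quenched_shift.
apply: (ge0_integral_preserving pmu (measurable_quenched mA)).
by move=> w; exact: measure_ge0.
Qed.

Let k A (w : Env R) : R := fine (quenched w A).

Let kE A w : measurable A -> quenched w A = (k A w)%:E.
Proof. by move=> mA; rewrite /k fineK// fin_num_measure. Qed.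

Let k01 A w : measurable A -> 0 <= k A w <= 1.
Proof. by move=> mA; rewrite -!lee_fin -kE// measure_ge0 probability_le1. Qed.

Let ik A : measurable A -> mu.-integrable setT (EFin \o k A).
Proof.
move=> mA; apply: (le_integrable measurableT (g := cst 1%E)).
- rewrite (_ : EFin \o k A = (fun w => quenched w A)); first exact: measurable_quenched.
  by apply/funext => w /=; rewrite -kE.
- move=> w _ /=; rewrite lee_fin normr1.
  by have /andP[? ?] := k01 w mA; rewrite ger0_norm.
- exact: finite_measure_integrable_cst.
Qed.

Let QE A : measurable A -> Q A = (\int[mu]_w (k A w)%:E)%E.
Proof. by move=> mA; rewrite /Q annealedE; apply: eq_integral => w _; rewrite kE. Qed.

Let shift_site_away (s s' : seq (int * nat)) : exists m0, forall m, (m0 <= m)%N ->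
  forall i j : int * nat, i \in s -> j \in s' -> shift_site m j != i.
Proof.
have bnd (t : seq (int * nat)) : exists K, forall i : int * nat, i \in t -> (`|i.1| <= K)%N.
  elim: t => [|i t [K hK]]; first by exists 0%N.
  exists (maxn `|i.1| K) => j; rewrite inE leq_max => /predU1P[->|/hK ->].
    by rewrite leqnn.
  by rewrite orbT.
have [K hK] := bnd s; have [K' hK'] := bnd s'.
exists (K + K').+1 => m mm i j /hK iK /hK' jK; apply/eqP => e.
have : (j.1 + m%:Z)%R = i.1 by rewrite -e.
by move: iK jK; case: (i) => x c; case: (j) => y b /=; lia.
Qed.

(** Far translates constrain arrows at other sites, and the product formula factorises. *)
Lemma quenched_decorrelate (w : Env R) s v s' v' : uniq s -> uniq s' ->
  exists m0, forall m, (m0 <= m)%N ->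
  quenched w (cylinder s v `&` iter m shift_arrows @^-1` cylinder s' v') =
  (quenched w (cylinder s v) * quenched w (iter m shift_arrows @^-1` cylinder s' v'))%E.
Proof.
move=> us us'; have [m0 h0] := shift_site_away s s'; exists m0 => m mm.
rewrite shift_arrows_cylinder; set t := map _ s'; set v'' := _ \o _.
have ut : uniq t by rewrite map_inj_uniq//; exact: shift_site_inj.
have st i : i \in t -> i \in s = false.
  move=> /mapP[j js' ->]; apply/negP => js; have := h0 m mm _ _ js js'.
  by rewrite eqxx.
pose f i := if i \in s then v i else v'' i.
have -> : cylinder s v `&` cylinder t v'' = cylinder (s ++ t) f.
  apply/seteqP; split => a.
    move=> [h1 h2] i; rewrite mem_cat /f; case: ifP => [is_ _|_ /= it]; first exact: h1.
    exact: h2.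
  move=> h; split => i ii; have := h i; rewrite mem_cat ii ?orbT => /(_ isT) ->.
    by rewrite /f ii.
  by rewrite /f st.
have ust : uniq (s ++ t).
  by rewrite cat_uniq us ut andbT /=; apply/hasPn => i it; rewrite /= st.
rewrite (quenched_cylinder w v us) (quenched_cylinder w v'' ut) (quenched_cylinder w f ust).
rewrite -EFinM big_cat /=; congr (_ * _)%:E; apply: eq_big_seq => i ii.
  by rewrite /f ii.
by rewrite /f st.
Qed.

(** For invariant [A] the quenched probability is an invariant function of the environment, hence
    almost surely a constant [c]. Quenched decorrelation from translated cylinders then makes [A]
    independent of every cylinder under [Q], hence of itself, so [c = c * c]. *)
Lemma ergodic_shift_arrows : ergodic_map Q shift_arrows.
Proof.
move=> A mA Ainv.
have kinv w : k A (Defs.shift w) = k A w by rewrite /k -quenched_shift// Ainv.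
have kc := ae_const pmu emu (ik mA) kinv.
set c := fine _ in kc.
have QA : Q A = c%:E by rewrite QE// /c fineK// (integrable_fin_num measurableT (ik mA)).
have iterA m : iter m shift_arrows @^-1` A = A.
  elim: m => [//|m IH]; rewrite -[RHS]IH -[in RHS]Ainv.
  by apply/seteqP; split => a.
have key s v : uniq s -> Q (A `&` cylinder s v) = (Q A * Q (cylinder s v))%E.
  move=> us; set B := cylinder s v.
  have mB : measurable (B : set arrow_space) by exact: measurable_cylinder.
  pose Bm m := iter m shift_arrows @^-1` B.
  have mBm m : measurable (Bm m).
    by rewrite -[X in measurable X]setTI; apply: measurable_iter => //; exact: preserving_shift_arrows.
  have mABm m : measurable (A `&` Bm m) by exact: measurableI.
  have QBm m : Q (Bm m) = Q B by exact: (preserving_iter preserving_shift_arrows m mB).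
  (* Invariance of [A] makes the annealed correlation independent of the translation [m], so its
     limit determines it. *)
  have QABm m : Q (A `&` Bm m) = Q (A `&` B).
    rewrite -(preserving_iter preserving_shift_arrows m (measurableI _ _ mA mB)).
    by congr (Q _); rewrite preimage_setI iterA.
  pose a m w : \bar R := (k (A `&` Bm m) w - c * k (Bm m) w)%:E.
  have ia m : (\int[mu]_w a m w = Q (A `&` B) - c%:E * Q B)%E.
    rewrite /a; under eq_integral do rewrite EFinB EFinM.
    have iz := integrableZl measurableT c (ik (mBm m)).
    rewrite (integralB measurableT (ik (mABm m)) iz).
    rewrite (integralZl measurableT (ik (mBm m))).
    by rewrite -(QE (mABm m)) -(QE (mBm m)) QBm QABm.
  (* For almost every environment [c] equals [k A w], so [a m w] is a quenched correlation, which
     tends to 0 and is bounded by 1. *)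
  have [|||||_ _] := @dominated_convergence _ _ _ mu setT measurableT a (cst 0%E) (cst 1%E).
  - move=> m; apply/measurable_EFinP; apply: measurable_funB.
      by apply/measurable_EFinP; exact: measurable_int (ik (mABm m)).
    apply: measurable_funM; first exact: measurable_cst.
    by apply/measurable_EFinP; exact: measurable_int (ik (mBm m)).
  - exact: measurable_cst.
  - move: kc; apply: filterS => w kw _; apply: cvg_EFin; first exact: nearW.
    suff : k (A `&` Bm m) w - c * k (Bm m) w @[m --> \oo] --> (0 : R) by [].
    rewrite -kw; apply: (decorrelation (P := quenched w) (cylindersE _ _) (@cylinders_setI _ _)) => //.
    move=> _ [->|[s1 [v1 [us1 ->]]]]; last exact: quenched_decorrelate.
    by exists 0%N => m _; rewrite set0I !measure0 mul0e.
  - exact: finite_measure_integrable_cst.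
  - move: kc; apply: filterS => w kw m _; rewrite /a -kw /= lee_fin.
    have /andP[x0 x1] := k01 w (mABm m); have /andP[y0 y1] := k01 w mA.
    have /andP[z0 z1] := k01 w (mBm m).
    have yz0 := mulr_ge0 y0 z0; have yz1 : k A w * k (Bm m) w <= 1 by rewrite mulr_ile1.
    by move: x0 x1 yz0 yz1; move: (k _ w) (k A w * _) => x y; rewrite ler_norml; lra.
  under eq_fun do rewrite ia.
  rewrite integral0 => h.
  have e : (Q (A `&` B) - c%:E * Q B = 0)%E.
    by apply: (cvg_unique (@ereal_hausdorff R) _ h); exact: cvg_cst.
  have fB : (c%:E * Q B)%E \is a fin_num by rewrite fin_numM// fin_num_measure.
  by rewrite QA -[RHS]add0e -[X in (X + _)%E]e subeK.
have keyA C : cylinders C -> exists m0, forall m : nat, (m0 <= m)%N ->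
    Q (C `&` A) = (Q C * Q A)%E.
  move=> [->|[s [v [us ->]]]]; exists 0%N => m _; first by rewrite set0I !measure0 mul0e.
  rewrite (setIC (cylinder s v)) (muleC (Q (cylinder s v))); exact: key.
(* The constant sequence [A] turns independence from cylinders into independence of [A] from
   itself. *)
have := decorrelation (P := Q) (cylindersE _ _) (@cylinders_setI _ _) (B := fun=> A) (fun=> mA) keyA mA.
rewrite setIid QA => h.
have : c - c * c = 0.
  by apply: (cvg_unique (@Rhausdorff R) _ h); exact: cvg_cst.
rewrite -{1}(mulr1 c) -mulrBr => /eqP; rewrite mulf_eq0 subr_eq0 => /orP[|] /eqP e.
  by left; rewrite e.
by right; rewrite -e.
Qed.

End ArrowErgodic.

(** * The law of the walk *)

Definition curried (a : arrow_space) : int -> nat -> bool := fun x c => a (x, c).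

Definition path_event (xs : seq int) : set arrow_space :=
  [set a | forall k, (k < size xs)%N -> pos (free (curried a)) 0 k = nth 0 xs k].

(** The cookie read at step [k], indexed as in [qstep]: the count includes the current visit, whence
    the predecessor. *)
Definition path_cookie (xs : seq int) (k : nat) : int * nat :=
  (nth 0 xs k, (count (pred1 (nth 0 xs k)) (take k.+1 xs)).-1).

Definition path_cookies (xs : seq int) : seq (int * nat) :=
  map (path_cookie xs) (iota 0 (size xs).-1).

(** The arrow prescribed at a cookie is read off the step using it; only values at [path_cookies xs]
    matter. *)
Definition path_arrow (xs : seq int) (i : int * nat) : bool :=
  let k := index i (path_cookies xs) in nth 0 xs k.+1 == nth 0 xs k + 1.

(** Through the default value 0 of [nth], the empty path is admissible. *)
Definition admissible (xs : seq int) : bool :=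
  (nth 0 xs 0 == 0) && all (fun k => (nth 0 xs k.+1 == nth 0 xs k + 1) ||
    (nth 0 xs k.+1 == nth 0 xs k - 1)) (iota 0 (size xs).-1).

Lemma visits_count D x n z :
  visits D x n z = count_mem z (map (pos D x) (iota 0 n)).
Proof.
elim: n => [//|n IH]; rewrite visitsS IH -addn1 iotaD map_cat count_cat /=.
by rewrite addn0.
Qed.

Lemma path_cookieE xs k : (k < size xs)%N ->
  path_cookie xs k = (nth 0 xs k, count_mem (nth 0 xs k) (take k xs)).
Proof.
move=> kn; rewrite /path_cookie (take_nth 0 kn) -cats1 count_cat /= eqxx.
by rewrite addn0 addn1.
Qed.

(** Between two departures from the same site the visit count has increased, so no cookie is used
    twice. *)
Lemma path_cookies_uniq xs : uniq (path_cookies xs).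
Proof.
rewrite map_inj_in_uniq ?iota_uniq// => j k; rewrite !mem_iota !add0n /= => jn kn.
have lt_neq j' k' : (j' < k')%N -> (k' < (size xs).-1)%N ->
    path_cookie xs j' = path_cookie xs k' -> False.
  move=> jk kn'; have ks : (k' < size xs)%N := leq_trans kn' (leq_pred _).
  have js := ltn_trans jk ks.
  rewrite !path_cookieE//.
  move=> [e]; rewrite -e.
  have : (count_mem (nth 0%R xs j') (take j'.+1 xs) <= count_mem (nth 0%R xs j') (take k' xs))%N.
    rewrite -(cat_take_drop j'.+1 (take k' xs)) count_cat take_takel//.
    exact: leq_addr.
  rewrite (take_nth 0 js) -cats1 count_cat /= eqxx addn1 => /[swap] ->.
  by rewrite ltnn.
move=> e; case: (ltngtP j k) => // jk; exfalso.
  exact: lt_neq e.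
by apply: lt_neq (esym e).
Qed.

Lemma path_arrowE xs k : (k < (size xs).-1)%N ->
  path_arrow xs (path_cookie xs k) = (nth 0 xs k.+1 == nth 0 xs k + 1).
Proof.
move=> kn; rewrite /path_arrow.
suff -> : index (path_cookie xs k) (path_cookies xs) = k by [].
have ks : (k < size (path_cookies xs))%N by rewrite size_map size_iota.
rewrite -[X in index X _](_ : nth (0, 0%N) (path_cookies xs) k = _).
  by rewrite index_uniq// path_cookies_uniq.
by rewrite (nth_map 0%N) ?size_iota// nth_iota.
Qed.

(** Following an admissible path means that each cookie it uses carries the prescribed arrow, which
    is a cylinder event. *)
Lemma path_eventE xs : path_event xs =
  if admissible xs then cylinder (path_cookies xs) (path_arrow xs) else set0.
Proof.
have walk_step (a : arrow_space) k : path_event xs a -> (k < (size xs).-1)%N ->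
    nth 0 xs k.+1 = nth 0 xs k + (if a (path_cookie xs k) then 1 else -1).
  move=> h kn; have kn1 : (k.+1 < size xs)%N by lia.
  have kn0 := ltnW kn1.
  rewrite -(h _ kn1) posS h// path_cookieE//.
  congr (_ + _); rewrite /free /curried visits_count.
  have -> // : [seq pos (free (curried a)) 0 i | i <- iota 0 k] = take k xs.
  apply: (@eq_from_nth _ 0); first by rewrite size_map size_iota size_takel// ltnW// ltnW.
  rewrite size_map size_iota => i ik.
  rewrite (nth_map 0%N) ?size_iota// nth_iota// h ?nth_take//.
  by rewrite (ltn_trans _ kn1)// ltnS ltnW.
case: ifPn => adm.
  have /andP[/eqP x0 /allP st] := adm.
  apply/seteqP; split => a ha.
    move=> _ /mapP[k + ->]; rewrite mem_iota /= add0n => kn.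
    rewrite path_arrowE// (walk_step _ _ ha kn).
    by case: (a _); [rewrite eqxx|apply/esym/eqP; lia].
  suff h n : forall k, (k <= n)%N -> (k < size xs)%N ->
      pos (free (curried a)) 0 k = nth 0 xs k by move=> k; exact: h.
  elim: n => [|n IH] k; first by rewrite leqn0 => /eqP ->; rewrite x0.
  rewrite leq_eqVlt => /predU1P[->|]; last by rewrite ltnS; exact: IH.
  move=> nn; have nn1 : (n < (size xs).-1)%N by lia.
  rewrite posS IH// ?(ltnW nn)//.
  have -> : visits (free (curried a)) 0 n (nth 0 xs n) = (path_cookie xs n).2.
    rewrite (path_cookieE (ltnW nn)) visits_count /=.
    congr (count _ _); apply: (@eq_from_nth _ 0).
      by rewrite size_map size_iota size_takel// ltnW// ltnW.
    rewrite size_map size_iota => i ik.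
    rewrite (nth_map 0%N) ?size_iota// nth_iota// IH ?nth_take// ?(ltnW ik)//.
    exact: ltn_trans ik (ltnW nn).
  have cn : path_cookie xs n \in path_cookies xs by apply: map_f; rewrite mem_iota.
  have := ha _ cn; rewrite path_arrowE// /free /curried.
  rewrite [path_cookie xs n]surjective_pairing /= => ->.
  have := st n; rewrite mem_iota /= => /(_ nn1).
  by case: eqP => [->//|_] /= /eqP ->.
apply/seteqP; split => // a ha; move/negP: adm; apply.
apply/andP; split.
  case: (xs) ha => [//|x s] ha; have := ha 0%N isT; by rewrite /= => <-.
apply/allP => k; rewrite mem_iota /= add0n => kn.
by rewrite (walk_step _ _ ha kn); case: (a _); rewrite eqxx ?orbT.
Qed.

Lemma measurable_path_event xs : measurable (path_event xs).
Proof.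
rewrite path_eventE; case: ifP => _; last exact: measurable0.
exact: measurable_cylinder.
Qed.

Section PathLaw.
Variable R : realType.

(** The product over steps is reindexed by cookies; a forbidden step gives a zero factor, and
    clamping does nothing here. *)
Lemma qprobE (w : env R) (xs : seq int) : (forall x c, 0 <= w x c <= 1) ->
  qprob w xs = if admissible xs then
    \prod_(i <- path_cookies xs) bit_prob (clamp01 (w i.1 i.2)) (path_arrow xs i)
  else 0.
Proof.
move=> w01.
have cl i : clamp01 (w i.1 i.2) = w i.1 i.2.
  have /andP[w0 w1] := w01 i.1 i.2.
  by rewrite /clamp01 (min_idPr w1) (max_idPr w0).
have -> : qprob w xs = (nth 0 xs 0 == 0)%:R * \prod_(k < (size xs).-1) qstep w xs k.
  by case: xs => [|//]; rewrite big_ord0 mulr1.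
rewrite /admissible; case: eqP => x0; last by rewrite mul0r.
rewrite mul1r /= -(big_mkord xpredT (qstep w xs)) /index_iota subn0.
case: ifPn => [/allP st|/allPn[k kn]].
  rewrite big_map; apply: eq_big_seq => k /[dup] kn; rewrite mem_iota add0n => kn'.
  rewrite path_arrowE// cl /bit_prob /qstep /=.
  by have := st k kn; case: eqP => //= _ ->.
rewrite negb_or => /andP[/negbTE k1 /negbTE k2].
rewrite (bigD1_seq k) ?iota_uniq//= /qstep k1 k2 mul0r.
by [].
Qed.

Lemma quenched_path (w : Env R) xs : (forall x c, 0 <= w x c <= 1) ->
  quenched w (path_event xs) = (qprob w xs)%:E.
Proof.
move=> w01; rewrite qprobE// path_eventE; case: ifP => _; last exact: measure0.
exact: quenched_cylinder (path_cookies_uniq xs).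
Qed.

End PathLaw.

(** * Laws of trajectories determined by initial segments *)

Definition initial_path (xs : seq int) : set (nat -> int) :=
  [set f | forall k, (k < size xs)%N -> f k = nth 0 xs k].

Lemma bigcup_countable_measurable d (T : measurableType d) (J : countType)
    (F : J -> set T) : (forall j, measurable (F j)) -> measurable (\bigcup_j F j).
Proof.
move=> mF.
have -> : \bigcup_j F j = \bigcup_n (if unpickle n is Some j then F j else set0).
  apply/seteqP; split => x; first by move=> [j _ Fj]; exists (pickle j) => //; rewrite pickleK.
  by move=> [n _]; case: unpickle => // j Fj; exists j.
by apply: bigcupT_measurable => n; case: unpickle => // j.
Qed.

(** There are countably many finite paths, so initial segments generate the coordinate events. *)
Lemma coord_initial_path (i : nat) (v : int) : [set f : nat -> int | f i = v] =
  \bigcup_xs (if (i < size xs)%N && (nth 0 xs i == v) then initial_path xs else set0).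
Proof.
apply/seteqP; split => f /=.
  move=> fi.
  have e k : (k < i.+1)%N -> nth 0 (map f (iota 0 i.+1)) k = f k.
    by move=> ki; rewrite (nth_map 0%N) ?size_iota// nth_iota.
  have sz : size (map f (iota 0 i.+1)) = i.+1 by rewrite size_map size_iota.
  move: (map f _) e sz => xs e sz; exists xs => //.
  by rewrite sz ltnSn e// fi eqxx /= => k; rewrite sz => ki; rewrite e.
move=> [xs _]; case: ifP => // /andP[ix /eqP <-]; exact.
Qed.

HB.instance Definition _ := isPointed.Build int 0.

Section Transfer.
Context d (T : measurableType d) (X : nat -> T -> int).
Hypothesis mX : forall xs, measurable [set t | initial_path xs (X^~ t)].

Definition trajectory (t : T) : fspace nat int := X^~ t.

Lemma measurable_trajectory : measurable_fun setT trajectory.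
Proof.
apply: measurable_fspace => i v.
have -> : [set t | trajectory t i = v] = trajectory @^-1` [set f | f i = v] by [].
rewrite coord_initial_path preimage_bigcup.
apply: bigcup_countable_measurable => xs; case: ifP => _; first exact: mX.
by rewrite preimage_set0.
Qed.

End Transfer.

Definition initial_paths : set (set (fspace nat int)) :=
  [set A | A = set0 \/ exists xs, A = initial_path xs].

Lemma initial_paths_setI : setI_closed initial_paths.
Proof.
move=> A B [->|[xs ->]]; first by rewrite set0I; left.
move=> [->|[ys ->]]; first by rewrite setI0; left.
wlog xy : xs ys / (size xs <= size ys)%N.
  move=> h; have [|/ltnW] := leqP (size xs) (size ys); first exact: h.
  by rewrite setIC; exact: h.
have [[f [fx fy]]|nf] := EM ((initial_path xs `&` initial_path ys) !=set0).
  right; exists ys; apply/seteqP; split => [g []//|g gy]; split => // k kx.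
  have ky := leq_trans kx xy.
  by rewrite gy// -fy// fx.
by left; apply/seteqP; split => // f hf; apply: nf; exists f.
Qed.

Lemma measurable_initial_path xs : measurable (initial_path xs : set (fspace nat int)).
Proof.
have -> : initial_path xs = cylinder (iota 0 (size xs)) (nth 0 xs).
  by apply/seteqP; split => f h k; have := h k; rewrite mem_iota.
exact: measurable_cylinder.
Qed.

Lemma initial_pathsE : @measurable _ (fspace nat int) = <<s initial_paths >>.
Proof.
apply/seteqP; split.
  apply: smallest_sub; first exact: smallest_sigma_algebra.
  move=> _ [i [v ->]]; rewrite coord_initial_path.
  apply: (@bigcup_countable_measurable _ (g_sigma_algebraType initial_paths)) => xs.
  case: ifP => _; last exact: measurable0.
  by apply: sub_sigma_algebra; right; exists xs.
apply: smallest_sub; first exact: sigma_algebra_measurable.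
by move=> _ [->|[xs ->]]; [exact: measurable0|exact: measurable_initial_path].
Qed.

Section AnnealedPath.
Context (R : realType) (mu : probability (Env R) R).
Hypothesis ellmu : elliptic mu.

Lemma ae_elliptic : {ae mu, forall w : Env R, forall x c, 0 < w x c < 1}.
Proof.
apply: (@probability1_ae _ _ _ mu
  [set w : Env R | forall x c, 0 < w x c < 1] _ ellmu).
have -> : [set w : Env R | forall x c, 0 < w x c < 1] =
    \bigcap_n (if unpickle n is Some i then
      [set w : Env R | 0 < w (i : int * nat).1 i.2 < 1] else setT).
  apply/seteqP; split => w h.
    by move=> n _; case: unpickle => // i; exact: h.
  by move=> x c; have := h (pickle (x, c)) I; rewrite pickleK.
apply: bigcapT_measurable => n; case: unpickle => // i.
have := @measurable_cookie R i.1 i.2 measurableT _ (measurable_itv `]0, 1[).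
by rewrite setTI; congr measurable; apply/seteqP; split => w /=; rewrite in_itv.
Qed.

Lemma measurable_qprob xs : measurable_fun setT (fun w : Env R => qprob w xs).
Proof.
case: xs => [|x0 s]; first exact: measurable_cst.
apply: measurable_funM; first exact: measurable_cst.
apply: measurable_prod => k _; rewrite /qstep.
case: (_ == _ + 1); first exact: measurable_cookie.
case: (_ == _ - 1); last exact: measurable_cst.
by apply: measurable_funB; [exact: measurable_cst|exact: measurable_cookie].
Qed.

(** Ellipticity puts almost every environment in the range where the quenched law of the walk is
    [qprob]. *)
Lemma annealed_path xs :
  annealed mu (path_event xs) = (\int[mu]_w (qprob w xs)%:E)%E.
Proof.
rewrite annealedE; apply: ae_eq_integral => //.
- exact: measurable_quenched (measurable_path_event xs).
- by apply/measurable_EFinP; exact: measurable_qprob.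
- move: ae_elliptic; apply: filterS => w h _; apply: quenched_path => x c.
  by have /andP[/ltW -> /ltW ->] := h x c.
Qed.

(** The law of the trajectory is determined on initial segments, a generating class closed under
    intersection; there the two laws agree by definition of [annealed_walk] and by
    [annealed_path]. *)
Lemma annealed_walk_law d (T : measurableType d) (P : probability T R) (X : nat -> T -> int)
    (B : set (fspace nat int)) : annealed_walk mu P X -> measurable B ->
  [/\ measurable [set t | B (X^~ t)],
    measurable [set a : arrow_space | B (pos (free (curried a)) 0)] &
    P [set t | B (X^~ t)] = annealed mu [set a | B (pos (free (curried a)) 0)]].
Proof.
move=> hX mB.
have mX := measurable_trajectory (fun xs => (hX xs).1).
have mW := @measurable_trajectory _ arrow_space (fun n a => pos (free (curried a)) 0 n)
  measurable_path_event.
split.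
- by rewrite -[X in measurable X]setTI; exact: mX.
- by rewrite -[X in measurable X]setTI; exact: mW.
pose tX : {mfun T >-> fspace nat int} :=
  HB.pack (trajectory X) (isMeasurableFun.Build _ _ _ _ _ mX).
pose tW : {mfun arrow_space >-> fspace nat int} :=
  HB.pack (trajectory (fun n (a : arrow_space) => pos (free (curried a)) 0 n))
    (isMeasurableFun.Build _ _ _ _ _ mW).
apply: (@probability_unique _ _ _ initial_paths (distribution P tX)
  (distribution (annealed mu) tW) initial_pathsE initial_paths_setI) => //.
- by right; exists [::]; apply/seteqP; split.
- move=> _ [->|[xs ->]]; first by rewrite !measure0.
  exact: etrans (hX xs).2 (esym (annealed_path xs)).
Qed.

End AnnealedPath.

Lemma measurable_speed (R : realType) (v : R) :
  measurable [set f : fspace nat int | (f n)%:~R / n%:R @[n --> \oo] --> v].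
Proof.
have -> : [set f : fspace nat int | (f n)%:~R / n%:R @[n --> \oo] --> v] =
    \bigcap_k \bigcup_N \bigcap_n
      (if (N <= n)%N then [set f : fspace nat int | `|v - (f n)%:~R / n%:R| <= k.+1%:R^-1] else setT).
  apply/seteqP; split => f /=.
    move=> /cvgrPdist_le h k _; have [N _ hN] := h k.+1%:R^-1 ltac:(by rewrite invr_gt0).
    by exists N => // n _; case: ifP => // Nn; exact: hN.
  move=> h; apply/cvgrPdist_le => e e0.
  have [N _ hN] := h (Num.truncn e^-1) I.
  exists N => // n /= Nn; have := hN n I; rewrite Nn => /= /le_trans; apply.
  by rewrite invf_ple ?posrE// ltW// truncnS_gt.
apply: bigcapT_measurable => k; apply: bigcupT_measurable => N.
apply: bigcapT_measurable => n; case: ifP => // _.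
have -> : [set f : fspace nat int | `|v - (f n)%:~R / n%:R| <= k.+1%:R^-1] =
    \bigcup_(z : int) (if `|v - z%:~R / n%:R| <= k.+1%:R^-1 then
      [set f : fspace nat int | f n = z] else set0).
  apply/seteqP; split => f /=; first by move=> h; exists (f n) => //; rewrite h.
  by move=> [z _]; case: ifP => // h ->.
apply: bigcup_countable_measurable => z; case: ifP => // _.
exact: measurable_coord.
Qed.

(** * Speed to the right *)

Lemma visits_le_time D x n z : (visits D x n z <= n)%N.
Proof.
elim: n => [//|n IH]; rewrite visitsS -addn1 leq_add//.
exact: leq_b1.
Qed.

Lemma returns1 b : returns 1 b = 1%N.
Proof. by rewrite /returns visitsS. Qed.

Lemma returns_le k k' b : (k <= k')%N -> (returns k b <= returns k' b)%N.
Proof. exact: visits_le. Qed.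

Lemma ex_invn_le (R : realType) (eps : R) : 0 < eps -> exists j : nat, j.+1%:R^-1 <= eps.
Proof.
move=> eps0; exists (Num.truncn eps^-1).
by rewrite invf_ple ?posrE// ltW// truncnS_gt.
Qed.

Lemma natr_subn_ge (R : realType) (n k : nat) :
  n%:R - k%:R <= (n.+1 - k)%:R :> R.
Proof. by rewrite lerBlDr -natrD ler_nat; lia. Qed.

Section MeasurableHistory.
Context d (S : measurableType d) (D : S -> int -> nat -> int).
Hypothesis mD : forall y c z, measurable [set s | D s y c = z].

(** A history takes countably many values, each determined by finitely many displacements. *)
Lemma measurable_hist x n (B : set (seq int)) :
  measurable [set s | B (hist (D s) x n)].
Proof.
have mh h : measurable [set s | hist (D s) x n = h].
  elim: n h => [|n IH] h.
    rewrite (_ : [set _ | _] = if [:: x] == h then setT else set0).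
      by case: ifP.
    by apply/seteqP; split => s /=; case: eqP.
  case: h => [|y h].
    by rewrite (_ : [set _ | _] = set0)//; apply/seteqP; split => s.
  rewrite (_ : [set _ | _] = [set s | hist (D s) x n = h] `&`
     [set s | D s (head 0 h) (count_mem (head 0 h) (behead h)) = y - head 0 h]).
    by apply: measurableI.
  apply/seteqP; split => s /=.
    by move=> [<- ->]; split => //; rewrite addrC addKr.
  by move=> [-> ->]; rewrite addrC subrK.
rewrite (_ : [set _ | _] = \bigcup_h (if `[< B h >] then [set s | hist (D s) x n = h] else set0)).
  by apply: bigcup_countable_measurable => h; case: ifP.
apply/seteqP; split => s /=.
  by move=> Bs; exists (hist (D s) x n) => //; case: asboolP.
by move=> [h _]; case: asboolP => //= Bh ->.
Qed.

End MeasurableHistory.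

(** [M] stands for the running maximum. The third bound gives [M <= n / m] up to errors, hence the
    upper bound on [x n]; inserted into the fourth it gives [x n >= n - (m - 1) * M >= n / m] up to
    errors. *)
Lemma speed_cvg (R : realType) (x : nat -> R) (m : R) : 1 <= m ->
  (forall e : R, 0 < e -> e <= 2^-1 -> exists C : R, forall n : nat, exists M : R,
    [/\ 0 <= M, x n <= M, (m - e) * M <= n%:R + C &
        n%:R + M - (m + e) * M - C <= x n]) ->
  x n / n%:R @[n --> \oo] --> m^-1.
Proof.
move=> m1 h; apply/cvgrPdist_le => dl dl0.
(* The bound 1/2 keeps [m - e >= 1/2]; the factor 8 leaves room for all error terms. *)
pose e := Num.min 2^-1 (dl / 8).
have e0 : 0 < e by rewrite lt_min invr_gt0 ltr0n divr_gt0.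
have e2 : e <= 2^-1 by rewrite /e ge_min lexx.
have e8 : 8 * e <= dl by rewrite mulrC -ler_pdivlMr// /e ge_min lexx orbT.
have [C hC] := h e e0 e2.
exists (Num.truncn (8 * `|C| / dl)).+1 => // n /= nn.
have n0 : 0 < n%:R :> R by rewrite ltr0n; case: n nn.
have Cn : 8 * `|C| <= dl * n%:R.
  rewrite [leRHS]mulrC -ler_pdivrMr//.
  apply: le_trans (_ : (Num.truncn (8 * `|C| / dl)).+1%:R <= _); last by rewrite ler_nat.
  by rewrite ltW// truncnS_gt.
have [M [M0 xM h1 h2]] := hC n.
have CC := ler_norm C.
have me : 2^-1 <= m - e by lra.
have m0 : 0 < m by lra.
have -> : m^-1 - x n / n%:R = (n%:R - m * x n) / (m * n%:R) by field; rewrite !gt_eqF.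
rewrite normrM normfV (gtr0_norm (mulr_gt0 m0 n0)) ler_pdivrMr ?mulr_gt0//.
rewrite ler_norml.
move: (n%:R) n0 Cn h1 h2 => {hC nn h} N N0 Cn h1 h2.
move: `|C| CC (normr_ge0 C) Cn => c Cc c0 Cn.
have hM : M <= 2 * (N + c).
  have : 2^-1 * M <= (m - e) * M by exact: ler_wpM2r.
  by lra.
have eM : e * M <= 2 * (e * N) + c.
  have : e * M <= e * (2 * (N + c)) by rewrite ler_pM2l.
  have : e * c <= 2^-1 * c by exact: ler_wpM2r.
  by rewrite mulrCA mulrDr; lra.
have eN : 8 * (e * N) <= dl * N by rewrite mulrA ler_pM2r.
have mdN : dl * N <= m * (dl * N).
  by rewrite ler_peMl// mulr_ge0// ltW.
rewrite (mulrCA dl).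
apply/andP; split.
  have mx : m * x n <= m * M by rewrite ler_pM2l.
  by move: h1; rewrite mulrBl; lra.
(* The lower bound on [x n] decreases in [M] because [m + e - 1 >= 0], so the upper bound on [M] can
   be inserted. *)
have me1 : 0 <= m + e - 1 by lra.
have P1 : (m + e - 1) * (m * M) <= (m + e - 1) * (N + c + e * M).
  by apply: ler_wpM2l => //; move: h1; rewrite mulrBl; lra.
have P2 : (m + e - 1) * (c + e * M) <= m * (c + e * M).
  by apply: ler_wpM2r; [rewrite addr_ge0// mulr_ge0// ltW|lra].
have P3 : m * (N - (m + e - 1) * M - c) <= m * x n.
  by rewrite ler_pM2l//; lra.
have P4 : m * (e * M + 2 * c) <= m * (2 * (e * N) + 3 * c) by rewrite ler_pM2l//; lra.
have P5 : m * (3 * (e * N) + 3 * c) <= m * (6 / 8 * (dl * N)) by rewrite ler_pM2l//; lra.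
have P6 : e * N <= m * (e * N) by rewrite ler_peMl// mulr_ge0// ltW.
by lra.
Qed.

Section SpeedOfArrows.
Variables (R : realType) (a : int -> nat -> bool).

Let X n : int := pos (free a) 0 n.

Let f k i : R := (returns k (shiftn i a))%:R.

(** One-sided: this says that the limsup of [x n / n] is at most 0. *)
Definition sublinear (x : nat -> R) := forall eps : R, 0 < eps ->
  exists N : nat, forall n, (N <= n)%N -> x n <= eps * n%:R.

Let sum_f_le k n M p : (p <= n)%N -> X p = M%:Z ->
  \sum_(i < M.+1 - k) f k i <= n%:R.
Proof.
by move=> pn XM; rewrite -natr_sum ler_nat (sum_returns_le k pn XM).
Qed.

Let running_maxN n : exists M : nat, (exists2 p, (p <= n)%N & X p = M%:Z) /\
  forall p, (p <= n)%N -> X p <= M%:Z.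
Proof.
have [M [M0 hM]] := running_max (free a) 0 n.
by exists `|M|%N; rewrite gez0_abs.
Qed.

(** Reaching the running maximum [M] takes at least about [c * M] steps, for every [c]. *)
Lemma sublinear_of_returns : (forall c : R, exists k, exists C : R,
    forall n : nat, c * n%:R - C <= \sum_(i < n) f k i) ->
  sublinear (fun n => (X n)%:~R).
Proof.
move=> h eps eps0.
(* Slope [2 / eps] bounds [M] by [eps / 2 * (n + |C|) + k]; the other half of [eps * n] absorbs the
   constants. *)
have [k [C hs]] := h (2 / eps).
exists (Num.truncn (`|C| + 2 * k%:R / eps)).+1 => n nn.
have [M [[m mn XM] hM]] := running_maxN n.
apply: le_trans (_ : M%:R <= _); first by have := hM n (leqnn _); rewrite -(ler_int R).
have h1 := sum_f_le k mn XM; have := le_trans (hs (M.+1 - k)%N) h1.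
 set t : R := (M.+1 - k)%:R => h2.
have t0 : 0 <= t by exact: ler0n.
have tM : M%:R - k%:R <= t := natr_subn_ge R M k.
have h3 : 2 / eps * t <= n%:R + `|C|.
  by have := ler_norm C; lra.
have h4 : t <= eps / 2 * (n%:R + `|C|).
  have : eps / 2 * (2 / eps * t) <= eps / 2 * (n%:R + `|C|).
    by rewrite ler_pM2l// divr_gt0.
  suff -> : eps / 2 * (2 / eps * t) = t by [].
  by field; rewrite gt_eqF.
have h5 : `|C| + 2 * k%:R / eps <= n%:R.
  apply: le_trans (_ : (Num.truncn (`|C| + 2 * k%:R / eps)).+1%:R <= _).
    by rewrite ltW// truncnS_gt.
  by rewrite ler_nat.
have : eps / 2 * (`|C| + 2 * k%:R / eps) <= eps / 2 * n%:R.
  by rewrite ler_pM2l// divr_gt0.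
have -> : eps / 2 * (`|C| + 2 * k%:R / eps) = eps / 2 * `|C| + k%:R.
  by field; rewrite gt_eqF.
by move: h4; rewrite mulrDr; lra.
Qed.


Section Integrable.
Variable V : nat -> R.
Hypothesis f_le_V : forall i k, f k i <= V i.

Let visits_le_V n i : (visits (free a) 0 n i%:Z <= Num.truncn (V i))%N.
Proof.
have [k hk] := visits_le_returns a i n.
apply: leq_trans hk _; rewrite truncn_ge_nat; first exact: f_le_V.
by apply: le_trans (f_le_V i 0%N); rewrite ler0n.
Qed.

(** The bounds [V i] make visits to each nonnegative site finite, so by [transientP] a walk that is
    not transient is bounded above. *)
Lemma not_transient_sublinear : ~ transient a 0 ->
  sublinear (fun n => (X n)%:~R).
Proof.
move=> ntr.
have [L hL] : exists L : nat, forall n, X n <= L%:Z.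
  apply: contrapT => hn; apply: ntr; apply: transientP.
    by move=> i; eexists => n; exact: visits_le_V.
  move=> L; apply: contrapT => hL; apply: hn; exists L => n.
  by rewrite leNgt; apply/negP => h; apply: hL; exists n.
move=> eps eps0; exists (Num.truncn (L%:R / eps)).+1 => n nn.
apply: le_trans (_ : L%:R <= _); first by have := hL n; rewrite -(ler_int R).
rewrite mulrC -ler_pdivrMr//.
apply: le_trans (_ : (Num.truncn (L%:R / eps)).+1%:R <= _).
  by rewrite ltW// truncnS_gt.
by rewrite ler_nat.
Qed.

Lemma transient_speed (m : R) (e : nat -> R) : 1 <= m -> e @ \oo --> m ->
  (forall j, exists C : R, forall n : nat,
    \sum_(i < n) V i <= (m + j.+1%:R^-1) * n%:R + C) ->
  (forall k j, exists C : R, forall n : nat,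
    (e k - j.+1%:R^-1) * n%:R - C <= \sum_(i < n) f k i) ->
  transient a 0 -> (X n)%:~R / n%:R @[n --> \oo] --> m^-1.
Proof.
move=> m1 e_cvg hb hf tr.
apply: speed_cvg => // eps eps0 eps2.
have eps20 : 0 < eps / 2 by rewrite divr_gt0.
have [n0 hn0] := tr 0.
have [j hj] := ex_invn_le eps0; have [C1 hC1] := hb j.
move: (j.+1%:R^-1 : R) hj hC1 => ij hj hC1.
have [j' hj'] := ex_invn_le eps20.
(* Half of [eps] pays for the truncation at [k], half for the Birkhoff error [ij']. *)
have [k hk] : exists k, m - eps / 2 <= e k.
  have /cvgrPdist_le/(_ _ eps20)[k _ hk] := e_cvg.
  by exists k; have := hk k (leqnn k); rewrite ler_norml; lra.
have [C2 hC2] := hf k j'.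
move: (j'.+1%:R^-1 : R) hj' hC2 => ij' hj' hC2.
(* [n0] pays for the times before the walk stays positive, [m + eps] for summing over [M + 1] sites,
   and [m * k] for the [k] sites lost to truncation. *)
exists (`|C1| + `|C2| + n0%:R + (m + eps) + m * k%:R) => n.
have [M [[p pn XM] hM]] := running_maxN n; exists M%:R.
have mk : 0 <= m * k%:R by rewrite mulr_ge0// ltW// (lt_le_trans ltr01).
have n00 : 0 <= n0%:R :> R by exact: ler0n.
have cc1 := ler_norm C1; have cc2 := ler_norm C2.
have nc1 := normr_ge0 C1; have nc2 := normr_ge0 C2.
split => //.
- by have := hM n (leqnn _); rewrite -(ler_int R).
- have h1 := sum_f_le k pn XM; have := le_trans (hC2 (M.+1 - k)%N) h1.
  set t : R := (M.+1 - k)%:R => h2.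
  have t0 : 0 <= t by exact: ler0n.
  have tM : M%:R - k%:R <= t := natr_subn_ge R M k.
  have h3 : (m - eps) * t <= (e k - ij') * t by apply: ler_wpM2r => //; lra.
  have h4 : (m - eps) * (M%:R - k%:R) <= (m - eps) * t.
    by apply: ler_wpM2l; [lra|exact: tM].
  have h5 : 0 <= eps * k%:R by rewrite mulr_ge0// ltW.
  have h6 : (m - eps) * (M%:R - k%:R) = (m - eps) * M%:R - (m * k%:R - eps * k%:R) by ring.
  by move: h4; rewrite h6; lra.
- have hinf : forall L : nat, exists2 n', (n <= n')%N & L%:Z < X n'.
    move=> L; have [n1 hn1] := tr L%:Z; exists (maxn n n1); first exact: leq_maxl.
    by apply: hn1; exact: leq_maxr.
  have hpos n' : (n0 <= n')%N -> 0 <= X n' by move=> /hn0/ltW.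
  have := pos_ge hinf hpos hM (fun n' i => visits_le_V n' i).
  set SV := (\sum_(_ < _) _)%N => h1.
  have h2 : SV%:R <= \sum_(i < M.+1) V i.
    rewrite natr_sum; apply: ler_sum => i _; rewrite truncn_le.
    by apply: le_trans (f_le_V i 0%N); rewrite ler0n.
  have h3 := le_trans h2 (hC1 M.+1).
  have h4 : (m + ij) * M.+1%:R <= (m + eps) * M.+1%:R.
    by apply: ler_wpM2r; [exact: ler0n|lra].
  have h5 : n%:R + M%:R + 1 - n0%:R - SV%:R <= (X n)%:~R :> R.
    move: h1; rewrite -(ler_int R) !rmorphB/= !rmorphD/=.
    by rewrite -!pmulrn.
  move: h4; rewrite -[in leRHS]natr1 mulrDr mulr1; lra.
Qed.

End Integrable.

End SpeedOfArrows.

(** * Dichotomy for an ergodic field of arrows *)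

Section RightSpeed.
Context d (S : measurableType d) (R : realType) (Q : probability S R).
Variables (tau : S -> S) (arr : S -> int -> nat -> bool).
Hypothesis ptau : preserving Q tau.
Hypothesis etau : ergodic_map Q tau.
Hypothesis marr : forall x c, measurable_fun setT (fun s => arr s x c).
Hypothesis arr_tau : forall s x c, arr (tau s) x c = arr s (x + 1) c.

Let X s n : int := pos (free (arr s)) 0 n.

Let shiftn_arr s i : shiftn i (arr s) = arr (iter i tau s).
Proof.
apply/funext => x; apply/funext => c; rewrite /shiftn.
elim: i x => [|i IH] x; first by rewrite addr0.
by rewrite iterS arr_tau -IH; congr (arr s _ c); lia.
Qed.

Let f k s : R := (returns k (arr s))%:R.

Let mreflected y c z : measurable [set s | reflected (arr s) y c = z].
Proof.
have := marr y c measurableT (Y := [set b : bool | (if b then 1 else if y == 0 then 0 else -1) = z]).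
by rewrite setTI; apply.
Qed.

Let mfree y c z : measurable [set s | free (arr s) y c = z].
Proof.
have := marr y c measurableT (Y := [set b : bool | (if b then 1 else -1) = z]).
by rewrite setTI; apply.
Qed.

Let mf k : measurable_fun setT (f k).
Proof.
move=> _ B mB; rewrite setTI.
exact: (measurable_hist mreflected 0 k [set h | B (count_mem 0 (behead h))%:R]).
Qed.

Let f_le k s : 0 <= f k s <= k%:R.
Proof. by rewrite ler0n ler_nat visits_le_time. Qed.

Let fi k : Q.-integrable setT (EFin \o f k).
Proof.
apply: (le_integrable measurableT (g := cst k%:R%:E)).
- exact/measurable_EFinP.
- move=> s _ /=; have /andP[f0 fk] := f_le k s.
  by rewrite lee_fin !ger0_norm.
- exact: finite_measure_integrable_cst.
Qed.

Let e k : R := fine (\int[Q]_s (f k s)%:E)%E.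

Let eE k : (\int[Q]_s (f k s)%:E)%E = (e k)%:E.
Proof. by rewrite fineK// (integrable_fin_num measurableT (fi k)). Qed.

Let e_le k k' : (k <= k')%N -> e k <= e k'.
Proof.
move=> kk; rewrite -lee_fin -!eE; apply: (le_integral measurableT (fi k) (fi k')).
by move=> s _; rewrite lee_fin ler_nat returns_le.
Qed.

Let birkhoff_ge : {ae Q, forall s, forall k j, exists C : R, forall n : nat,
  (e k - j.+1%:R^-1) * n%:R - C <= \sum_(i < n) f k (iter i tau s)}.
Proof.
apply: ae_foralln => k; apply: ae_foralln => j.
have fNi : Q.-integrable setT (EFin \o (fun s => - f k s)).
  by have := integrableN (fi k); rewrite /comp; under eq_fun do rewrite -EFinN.
have : (\int[Q]_s (- f k s)%:E < (- (e k - j.+1%:R^-1))%:E)%E.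
  have -> : (\int[Q]_s (- f k s)%:E = - (e k)%:E)%E.
    rewrite -eE; under eq_integral do rewrite EFinN.
    by rewrite integralN// (integrable_add_def measurableT (fi k)).
  by rewrite -EFinN lte_fin ltrN2 gtrBl.
move=> /(birkhoff_le ptau etau fNi); apply: filterS => s [C hC].
exists C => n; have := hC n; rewrite sumrN.
by rewrite lerNl opprD mulNr opprK.
Qed.

Let f_shiftn k i s : f k (iter i tau s) = (returns k (shiftn i (arr s)))%:R.
Proof. by rewrite shiftn_arr. Qed.

Let sublinear_unbounded : (forall C, exists k, C < e k) ->
  {ae Q, forall s, sublinear (fun n => (X s n)%:~R : R)}.
Proof.
move=> hC; move: birkhoff_ge; apply: filterS => s hs.
(* The extra 1 compensates the error [1 / (j + 1)] at [j = 0]. *)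
apply: sublinear_of_returns => c; have [k hk] := hC (c + 1).
have [C {}hs] := hs k 0%N; exists k, C => n; have := hs n.
under eq_bigr do rewrite f_shiftn.
apply: le_trans; rewrite lerB// ler_wpM2r// invr1.
by lra.
Qed.

Section Bounded.
Variable C0 : R.
Hypothesis e_bounded : forall k, e k <= C0.

Let g s : \bar R := limn (fun k => (f k s)%:E).

Let f_nd s : nondecreasing_seq (fun k => (f k s)%:E).
Proof. by move=> k k' kk; rewrite lee_fin ler_nat returns_le. Qed.

Let g_cvg s : (fun k => (f k s)%:E) @ \oo --> g s.
Proof. exact: ereal_nondecreasing_is_cvgn. Qed.

Let f_g k s : ((f k s)%:E <= g s)%E.
Proof.
have -> : g s = ereal_sup (range (fun k => (f k s)%:E)).
  by apply/cvg_lim => //; exact: ereal_nondecreasing_cvgn.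
by apply: ereal_sup_ubound; exists k.
Qed.

Let g_ge0 s : (0 <= g s)%E.
Proof. by apply: le_trans (f_g 0 s); rewrite lee_fin ler0n. Qed.

Let mg : measurable_fun setT g.
Proof.
apply: (emeasurable_fun_cvg (fun k s => (f k s)%:E)).
  by move=> k; exact/measurable_EFinP.
by move=> s _; exact: g_cvg.
Qed.

Let int_g : (fun k => (e k)%:E) @ \oo --> (\int[Q]_s g s)%E.
Proof.
under eq_fun do rewrite -eE.
apply: cvg_monotone_convergence => //.
- by move=> k; exact/measurable_EFinP.
- by move=> k s _; rewrite lee_fin ler0n.
Qed.

Let gi : Q.-integrable setT g.
Proof.
apply/integrableP; split => //.
under eq_integral do rewrite gee0_abs//.
apply: le_lt_trans (ltry C0); apply: cvge_le int_g.
by apply: nearW => k; rewrite lee_fin.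
Qed.

(** Real-valued version of [g]; an infinite value becomes 0, which happens on a null set only. *)
Let V s : R := fine (g s).

Let g_fin : {ae Q, forall s, g s = (V s)%:E}.
Proof.
move: (integrable_ae measurableT gi); apply: filterS => s /(_ I) gs.
by rewrite /V fineK.
Qed.

Let Vi : Q.-integrable setT (EFin \o V).
Proof.
apply: (le_integrable measurableT _ _ gi).
  by apply/measurable_EFinP; apply: measurableT_comp mg; exact: fine_measurable.
move=> s _ /=; rewrite /V; case: (g s) => [r| |] //=; by rewrite normr0 leey.
Qed.

Let m : R := fine (\int[Q]_s (V s)%:E)%E.

Let int_V : (\int[Q]_s (V s)%:E = m%:E)%E.
Proof. by rewrite fineK// (integrable_fin_num measurableT Vi). Qed.

Let e_cvg : e @ \oo --> m.
Proof.
have : (\int[Q]_s g s = m%:E)%E.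
  rewrite -int_V; apply: ae_eq_integral => //.
    exact: measurable_int Vi.
  by move: g_fin; apply: filterS => s -> _.
by move=> gm; have := int_g; rewrite gm => /fine_cvgP[].
Qed.

(** Time 0 is already a visit to 0, so the first truncation has mean 1. *)
Let m_ge1 : 1 <= m.
Proof.
have -> : 1 = e 1.
  rewrite /e (eq_integral (cst 1%E)); last by move=> s _; rewrite /f returns1.
  rewrite integral_cst// mul1e.
  by rewrite [X in fine X](_ : _ = 1%E); last exact: probability_setT.
have <- : limn e = m by exact/cvg_lim.
by apply: nondecreasing_cvgn_le => //; apply/cvg_ex; exists m.
Qed.

Let V_ge : {ae Q, forall s, forall i k, f k (iter i tau s) <= V (iter i tau s)}.
Proof.
move: (ae_iter ptau g_fin); apply: filterS => s gs i k.
by rewrite -lee_fin -gs.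
Qed.

Let birkhoff_V : {ae Q, forall s, forall j, exists C : R, forall n : nat,
  \sum_(i < n) V (iter i tau s) <= (m + j.+1%:R^-1) * n%:R + C}.
Proof.
apply: ae_foralln => j; apply: (birkhoff_le ptau etau Vi).
by rewrite int_V lte_fin ltrDl.
Qed.

Let good s := [/\ forall i k, f k (iter i tau s) <= V (iter i tau s),
  forall j, exists C : R, forall n : nat,
    \sum_(i < n) V (iter i tau s) <= (m + j.+1%:R^-1) * n%:R + C &
  forall k j, exists C : R, forall n : nat,
  (e k - j.+1%:R^-1) * n%:R - C <= \sum_(i < n) f k (iter i tau s)].

Let ae_good : {ae Q, forall s, good s}.
Proof. by move: birkhoff_ge; apply: filterS3 V_ge birkhoff_V; split. Qed.

Let A := [set s | transient (arr s) 0].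

Let mA : measurable A.
Proof.
have -> : A = \bigcap_L \bigcup_n0 \bigcap_n
    (if (n0 <= n)%N then [set s | (L%:Z < X s n)%R] else setT).
  apply/seteqP; split => s h L.
    move=> _; have [n0 hn0] := h L%:Z; exists n0 => // n _.
    by case: ifP => // nn; exact: hn0.
  have [n0 _ hn0] := h `|L|%N I; exists n0 => n nn; have := hn0 n I.
  by rewrite nn; apply: le_lt_trans; rewrite abszE ler_norm.
apply: bigcapT_measurable => L; apply: bigcupT_measurable => n0.
apply: bigcapT_measurable => n; case: ifP => // _.
exact: (measurable_hist mfree 0 n [set h | (L%:Z < head 0 h)%R]).
Qed.

(** The walk from 1, seen from 1, is the walk from 0 in the arrows of [tau s]. *)
Let A_tau s : A s -> A (tau s).
Proof.
move=> /transient_succ h L; have [n0 hn0] := h (L + 1).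
exists n0 => n /hn0; have [] := pos_shift (free (arr s)) 1 0 n.
have -> : (fun z => [eta free (arr s) (z + 1)]) = free (arr (tau s)).
  by apply/funext => z; apply/funext => c; rewrite /free arr_tau.
by rewrite add0r => -> _; rewrite ltrD2r.
Qed.

(** [A] is only included in its preimage. The increasing union of its iterated preimages is strictly
    invariant and has the measure of [A], since all these preimages do. *)
Let QA : Q A = 0%E \/ Q A = 1%E.
Proof.
pose F n := iter n tau @^-1` A.
have mF n : measurable (F n).
  by rewrite -[X in measurable X]setTI; exact: (measurable_iter ptau n measurableT).
have mUF : measurable (\bigcup_n F n) by exact: bigcupT_measurable.
have ndF : nondecreasing_seq F.
  apply/nondecreasing_seqP => n; apply/subsetPset => s.
  by rewrite /F /preimage /=; exact: A_tau.
have UF : tau @^-1` (\bigcup_n F n) = \bigcup_n F n.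
  apply/seteqP; split => s /= [n _ Fn].
    by exists n.+1 => //; rewrite /F /preimage /= -iterS iterSr.
  by exists n => //; rewrite /F /preimage /= -iterSr; exact: A_tau.
have <- : Q (\bigcup_n F n) = Q A; last exact: etau.
apply: (cvg_unique (@ereal_hausdorff R) (nondecreasing_cvg_mu _ _ ndF)) => //.
rewrite (_ : _ \o F = cst (Q A)); first exact: cvg_cst.
by apply/funext => n; exact: (preserving_iter ptau n mA).
Qed.

Lemma right_speed_dichotomy_integrable :
  (exists2 v : R, 0 < v <= 1 & {ae Q, forall s, (X s n)%:~R / n%:R @[n --> \oo] --> v}) \/
  {ae Q, forall s, sublinear (fun n => (X s n)%:~R : R)}.
Proof.
case: QA => QA01.
  right; have : {ae Q, forall s, ~ A s}.
    by exists A; split => // s /= h; apply: contrapT.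
  move: ae_good; apply: filterS2 => s [hV _ _]; apply: (@not_transient_sublinear _ _ (fun i => V (iter i tau s))).
  by move=> i k; rewrite -f_shiftn.
left; exists m^-1.
  by rewrite invr_gt0 (lt_le_trans ltr01)//= invf_le1// (lt_le_trans ltr01).
have := probability1_ae mA QA01.
move: ae_good; apply: filterS2 => s [hV hb hf].
apply: (@transient_speed _ _ (fun i => V (iter i tau s)) _ m e) => //.
  by move=> i k; rewrite -f_shiftn.
move=> k j; have [C hC] := hf k j; exists C => n.
by under eq_bigr do rewrite -f_shiftn.
Qed.

End Bounded.

(** The two cases are [E(V)] finite and infinite. The abstract field of arrows lets the result apply
    to the annealed arrows and to their reflection. *)
Theorem right_speed_dichotomy :
  (exists2 v : R, 0 < v <= 1 & {ae Q, forall s, (X s n)%:~R / n%:R @[n --> \oo] --> v}) \/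
  {ae Q, forall s, sublinear (fun n => (X s n)%:~R : R)}.
Proof.
have [[C0 hC]|hC] := EM (exists C0, forall k, e k <= C0).
  exact: right_speed_dichotomy_integrable hC.
right; apply: sublinear_unbounded => C; apply: contrapT => h; apply: hC.
by exists C => k; rewrite leNgt; apply/negP => hk; apply: h; exists k.
Qed.

End RightSpeed.

(** * The law of large numbers *)

Lemma sublinear_cvg0 (R : realType) (x : nat -> R) :
  sublinear x -> sublinear (fun n => - x n) -> x n / n%:R @[n --> \oo] --> (0 : R).
Proof.
move=> h1 h2; apply/cvgrPdist_le => e e0.
have [N1 hN1] := h1 e e0; have [N2 hN2] := h2 e e0.
exists (maxn 1 (maxn N1 N2)) => // n /=; rewrite !geq_max => /and3P[n1 nN1 nN2].
rewrite sub0r normrN normrM normfV normr_nat ler_pdivrMr ?ltr0n// ler_norml.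
by rewrite hN1// lerNl hN2.
Qed.

(** Reflecting the line exchanges the shift with its inverse, so the reflected field is driven by
    this map. *)
Definition unshift_arrows (a : arrow_space) : arrow_space :=
  fun i => a (i.1 - 1, i.2).

Lemma shift_arrowsK a : unshift_arrows (shift_arrows a) = a.
Proof. by apply/funext => -[x c]; rewrite /shift_arrows /unshift_arrows /= subrK. Qed.

Definition reflect_arrows (a : arrow_space) : int -> nat -> bool :=
  fun x c => ~~ a (- x, c).

Lemma pos_reflect_arrows a n :
  pos (free (reflect_arrows a)) 0 n = - pos (free (curried a)) 0 n.
Proof.
have [+ _] := pos_opp (free (curried a)) 0 n; rewrite oppr0 => <-.
congr (pos _ 0 n); apply/funext => x; apply/funext => c.
by rewrite /free /reflect_arrows /curried; case: (a _).
Qed.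

Section Speed.
Context (R : realType) (mu : probability (Env R) R).
Hypotheses (smu : stationary mu) (emu : ergodic mu).

Let Q := annealed mu.

Let mcoord (i : int * nat) : measurable_fun setT (fun a : arrow_space => a i).
Proof.
apply: (measurable_fun_bool true); rewrite setTI.
exact: measurable_coord.
Qed.

Let pQ : preserving Q shift_arrows := preserving_shift_arrows smu.

Let munshift : measurable_fun setT unshift_arrows.
Proof. by apply: measurable_fspace => i v; exact: measurable_coord. Qed.

Let punshift : preserving Q unshift_arrows.
Proof.
split=> [|A mA]; first exact: munshift.
have mB : measurable (unshift_arrows @^-1` A).
  by rewrite -[X in measurable X]setTI; exact: munshift.
apply: eq_trans (esym (pQ.2 _ mB)) _; apply: congr1.
by apply/seteqP; split => a; rewrite /preimage /= shift_arrowsK.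
Qed.

Let eunshift : ergodic_map Q unshift_arrows.
Proof.
move=> A mA Ainv; apply: (ergodic_shift_arrows smu emu mA).
rewrite -[in LHS]Ainv.
by apply/seteqP; split => a; rewrite /preimage /= shift_arrowsK.
Qed.

(** A positive speed on either side settles the limit; otherwise both the walk and its negative are
    sublinear, and the speed is 0. *)
Lemma annealed_speed : exists2 v : R, -1 <= v <= 1 &
  {ae Q, forall a, (pos (free (curried a)) 0 n)%:~R / n%:R @[n --> \oo] --> v}.
Proof.
have [[v /andP[v0 v1] hv]|h1] := @right_speed_dichotomy _ _ R Q shift_arrows curried pQ
    (ergodic_shift_arrows smu emu) (fun x c => mcoord (x, c)) (fun _ _ _ => erefl).
  by exists v => //; rewrite v1 andbT (le_trans _ (ltW v0))// oppr_le0 ler01.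
have [||[v /andP[v0 v1] hv]|h2] := @right_speed_dichotomy _ _ R Q unshift_arrows reflect_arrows
    punshift eunshift.
- by move=> x c; apply: measurable_neg; exact: mcoord.
- move=> a x c; rewrite /reflect_arrows /unshift_arrows /=.
  by congr (~~ a (_, c)); ring.
- exists (- v); first by rewrite lerN2 v1 /= (le_trans _ ler01)// oppr_le0 ltW.
  move: hv; apply: filterS => a ha.
  have -> : (fun n => (pos (free (curried a)) 0 n)%:~R / n%:R : R) =
      (fun n => - ((pos (free (reflect_arrows a)) 0 n)%:~R / n%:R)).
    by apply/funext => n; rewrite pos_reflect_arrows rmorphN /= mulNr opprK.
  exact: cvgN.
- exists 0; first by rewrite ler01 oppr_le0 ler01.
  move: h1 h2; apply: filterS2 => a h1 h2; apply: sublinear_cvg0 => //.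
  by move=> eps /h2[N hN]; exists N => n /hN; rewrite pos_reflect_arrows rmorphN.
Qed.

End Speed.

Theorem theorem1p2 (R : realType) (mu : probability (Env R) R) :
  stationary mu -> ergodic mu -> elliptic mu ->
  exists v : R, -1 <= v <= 1 /\
    forall (d : measure_display) (T : measurableType d) (P : probability T R)
           (X : nat -> T -> int),
      annealed_walk mu P X ->
      let E := [set t | (fun n : nat => (X n t)%:~R / n%:R) @ \oo --> v] in
      measurable E /\ P E = 1%E.
Proof.
move=> smu emu ellmu; have [v v1 hv] := annealed_speed smu emu.
exists v; split => // d T P X hX E.
(* Having speed [v] is a measurable property of the trajectory alone, so its probability can be
   computed for the walk driven by the annealed arrows. *)
have [mE mW PE] := annealed_walk_law ellmu hX (measurable_speed v).
split; first exact: mE.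
by rewrite PE; apply: ae_probability1.
Qed.
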